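(* Let $a_1(x):=(1-(3-e)x)^2$ for $x\in[0,1]$. On every $1$-regular input $(G,\bm{x})$ (with $G$ an arbitrary graph), Algorithm 2 (Attenuate-ROM) with attenuation function $a_1$ selects every edge $e$ with probability at least $\gamma x_e$, where \[ \gamma=\frac{e^2-4e^3+e^4+20e-22}{4e^2}\ge 0.474035. \]
   Context: Here $e$ in the formulas denotes Euler's number. For a finite graph $G=(V,E)$, $\partial(v)$ is the set of edges incident to $v$. A fractional matching is $\bm{x}\in[0,1]^E$ with $\sum_{f\in\partial(v)}x_f\le1$ for all $v$; $(G,\bm{x})$ is $1$-regular if equality holds at every vertex. Each edge $f$ is active independently with probability $x_f$. The edges arrive in a uniformly random order. Algorithm 2 (Attenuate-ROM) with attenuation function $a:[0,1]\to[0,1]$: start with $\mathcal{M}=\emptyset$; when edge $f$ arrives, draw an independent $A_f\sim\mathrm{Ber}(a(x_f))$, and add $f$ to $\mathcal{M}$ if $f$ is active, $A_f=1$, and neither endpoint of $f$ is covered by an edge already in $\mathcal{M}$; output $\mathcal{M}$. *)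

(* Defs.v *)
From mathcomp Require Import all_boot all_order all_algebra.
From mathcomp Require Import reals sequences exp bernoulli_distribution.

Set Implicit Arguments.
Unset Strict Implicit.
Unset Printing Implicit Defensive.

Import Order.TTheory GRing.Theory Num.Theory.

Local Open Scope ring_scope.

(* A finite simple graph (V, E) is given by a finite type V of vertices and a
   set E of two-element subsets of V. *)
Definition simple_graph (V : finType) (E : {set {set V}}) : Prop :=
  forall f : {set V}, f \in E -> #|f| = 2%N.

Definition incident (V : finType) (E : {set {set V}}) (v : V) :
    {set {set V}} :=
  [set f in E | v \in f].

(* Edge vectors are functions on all of {set V}; only their values on E are
   ever used. *)
Definition fractional_matching (R : realType) (V : finType)
    (E : {set {set V}}) (x : {set V} -> R) : Prop :=
  (forall f : {set V}, f \in E -> 0 <= x f <= 1) /\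
  (forall v : V, \sum_(f in incident E v) x f <= 1).

Definition one_regular (R : realType) (V : finType)
    (E : {set {set V}}) (x : {set V} -> R) : Prop :=
  fractional_matching E x /\
  (forall v : V, \sum_(f in incident E v) x f = 1).

Definition covered (V : finType) (M : {set {set V}}) (v : V) : bool :=
  [exists g in M, v \in g].

(* The output of Attenuate-ROM on a fixed outcome of its random choices: the
   edges arrive in the order s, act is the set of active edges, and att is the
   set of edges f with A_f = 1. *)
Definition attenuate_rom (V : finType) (s : seq {set V})
    (act att : {set {set V}}) : {set {set V}} :=
  foldl (fun (M : {set {set V}}) (f : {set V}) =>
           if [&& f \in act, f \in att & [forall v in f, ~~ covered M v]]
           then f |: M else M)
        set0 s.

(* Law of the random subset of E containing each f independently with
   probability p f. *)
Definition bernoulli_set (R : realType) (V : finType) (E : {set {set V}})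
    (p : {set V} -> R) (S : {set {set V}}) : R :=
  \prod_(f in E) bernoulli_pmf (p f) (f \in S).

(* Probability that Attenuate-ROM selects h. The arrival order is uniform over
   the duplicate-free list of all orderings of E; the order, the active set and
   the attenuation bits are independent, so the bits A_f may be drawn before
   the edges arrive. *)
Definition selection_prob (R : realType) (V : finType) (E : {set {set V}})
    (x : {set V} -> R) (a : R -> R) (h : {set V}) : R :=
  \sum_(s <- permutations (enum E))
    (size (permutations (enum E)))%:R^-1 *
    \sum_(act in powerset E) \sum_(att in powerset E)
      bernoulli_set E x act * bernoulli_set E (fun f => a (x f)) att *
      (h \in attenuate_rom s act att)%:R.

(* expR 1 is Euler's number. *)
Definition a1 (R : realType) (x : R) : R := (1 - (3 - expR 1) * x) ^+ 2.

Definition gamma (R : realType) : R :=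
  let e : R := expR 1 in
  (e ^+ 2 - 4 * e ^+ 3 + e ^+ 4 + 20 * e - 22) / (4 * e ^+ 2).

(* Main.v *)
Require Import Defs.
From mathcomp Require Import all_boot all_order all_algebra.
From mathcomp Require Import ring lra zify.
From mathcomp Require Import reals boolp functions topology normedtype derive realfun.
From mathcomp Require Import sequences exp bernoulli_distribution.

(* Write r_g = x_g a1(x_g) for the probability that g is active and not
   attenuated, and give every edge an independent uniform arrival time in [0, 1].
   The edge e, arriving at time y, is selected if no such adjacent edge arrived
   before it, or if exactly one, f, did and f was blocked by an edge h disjoint
   from e, where h is the only competitor of f before f and h has no competitor
   before itself.  These events are disjoint, and their probabilities are
   integrals of products of factors 1 - t r_g over 0 < s < z < y < 1.

   Since a1 is a square, the blocking term of an edge h of mass q is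
   (1 - c q)^2 psi(y)^2 / 2 with c = 3 - exp(1) and psi(y) the integral of
   exp(- (1 - q) s) over [0, y].  It is at least A(y) + (1 - q) B(y), where A(y)
   is its value for q = 1 and B has nonnegative weighted integral.  In the limit
   where e has mass 0 and all the edges h have mass 1 one gets
   gamma = int_0^1 exp(- 2 y) (1 + a1(1) y^2) dy.  A triangle on e loses blocking
   mass, but its two edges f = uw and vw gain from 1 - y r_g > exp(- y x_g); by
   2 x_uw x_vw <= x_uw^2 + x_vw^2 this trade-off splits into one inequality in a
   single variable for each edge f adjacent to e. *)

Set Implicit Arguments.
Unset Strict Implicit.
Unset Printing Implicit Defensive.

Import Order.TTheory GRing.Theory Num.Theory.
Import numFieldNormedType.Exports.

Local Open Scope ring_scope.

(** * The random order and the random active set *)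

Section BernoulliExpectation.
Variables (R : realType) (V : finType) (E : {set {set V}}).
Implicit Types (p q : {set V} -> R) (S : {set {set V}}).

Definition bexp p (F : {set {set V}} -> R) : R :=
  \sum_(S in powerset E) bernoulli_set E p S * F S.

Lemma eq_bexp p F F' : F =1 F' -> bexp p F = bexp p F'.
Proof. by move=> h; apply: eq_bigr => S _; rewrite h. Qed.

Lemma bexp_sum (I : Type) (r : seq I) (P : pred I) p F :
  bexp p (fun S => \sum_(i <- r | P i) F i S) = \sum_(i <- r | P i) bexp p (F i).
Proof.
by rewrite /bexp exchange_big; apply: eq_bigr => S _; rewrite mulr_sumr.
Qed.

Lemma bexpD p F F' : bexp p (fun S => F S + F' S) = bexp p F + bexp p F'.
Proof. by rewrite /bexp -big_split; apply: eq_bigr => S _; rewrite mulrDr. Qed.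

Lemma bexp_prod p (phi : {set V} -> bool -> R) :
  bexp p (fun S => \prod_(g in E) phi g (g \in S)) =
  \prod_(g in E) (p g * phi g true + (1 - p g) * phi g false).
Proof.
pose F g := if g \in E then p g * phi g true else 0.
pose G g := if g \in E then (1 - p g) * phi g false else 1.
transitivity (\prod_g (F g + G g)); last first.
  rewrite [RHS]big_mkcond; apply: eq_bigr => g _; rewrite /F /G.
  by case: (g \in E); rewrite ?add0r.
rewrite bigA_distr (bigID [pred S : {set {set V}} | S \in powerset E]) /=.
rewrite [X in _ = _ + X]big1 ?addr0 => [|S].
  apply: eq_big => [S|S]; first by rewrite inE.
  rewrite /bernoulli_set -big_split powersetE => SE /=.
  rewrite big_mkcond; apply: eq_bigr => g _; rewrite /F /G /bernoulli_pmf.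
  case gS: (g \in S); first by rewrite (subsetP SE).
  by case: (g \in E).
rewrite !inE /= => /subsetPn[g gS gE].
by rewrite (bigD1 g) //= gS /F (negPf gE) mul0r.
Qed.

Lemma sum_indicator_eq (F : {set {set V}} -> R) S : S \in powerset E ->
  F S = \sum_(T in powerset E) F T * (\prod_(g in E) ((g \in S) == (g \in T))%:R : R).
Proof.
move=> SE; rewrite (bigD1 S) //= [X in _ = _ + X]big1 ?addr0.
  by rewrite big1 ?mulr1 // => g _; rewrite eqxx.
move=> T /andP[TE TS].
have [g gE gST] : exists2 g, g \in E & (g \in S) != (g \in T).
  have [/existsP[g /andP[]]|] := boolP [exists g, (g \in E) && ((g \in S) != (g \in T))].
    by exists g.
  rewrite negb_exists => /forallP h; case/negP: TS; apply/eqP/setP => g.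
  have := h g; rewrite negb_and negbK => /orP[gE|/eqP ->] //.
  rewrite !powersetE in SE TE.
  by rewrite (contraNF (subsetP SE g) gE) (contraNF (subsetP TE g) gE).
by rewrite (bigD1 g) //= (negPf gST) mul0r mulr0.
Qed.

Lemma bexp_setI p q (F : {set {set V}} -> R) :
  bexp p (fun S => bexp q (fun T => F (S :&: T))) = bexp (fun f => p f * q f) F.
Proof.
transitivity (\sum_(U in powerset E) F U *
   bexp p (fun S => bexp q (fun T =>
     \prod_(g in E) ((g \in S :&: T) == (g \in U))%:R))).
  rewrite /bexp; under [RHS]eq_bigr => U _.
    rewrite mulr_sumr; under eq_bigr => S _ do rewrite mulrCA !mulr_sumr.
    over.
  rewrite exchange_big /=; apply: eq_bigr => S SE.
  rewrite mulr_sumr exchange_big /=; apply: eq_bigr => T TE.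
  rewrite (sum_indicator_eq F (S := S :&: T)); last first.
    by rewrite powersetE subIset // -powersetE SE.
  rewrite !mulr_sumr; apply: eq_bigr => U _.
  ring.
rewrite /bexp [RHS]big_seq_cond [LHS]big_seq_cond.
apply: eq_bigr => U _.
under eq_bigr => S _.
  have -> : \sum_(T in powerset E) bernoulli_set E q T *
      \prod_(g in E) ((g \in S :&: T) == (g \in U))%:R =
    \prod_(g in E) (q g * (((g \in S) && true) == (g \in U))%:R +
                    (1 - q g) * (((g \in S) && false) == (g \in U))%:R) :> R.
    rewrite -(bexp_prod q (fun g b => (((g \in S) && b) == (g \in U))%:R)).
    by apply: eq_bexp => T; apply: eq_bigr => g _; rewrite inE.
  over.
rewrite [X in _ * X = _](bexp_prod p (fun g b =>
   (q g * ((b && true) == (g \in U))%:R + (1 - q g) * ((b && false) == (g \in U))%:R))).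
rewrite mulrC; congr *%R; apply: eq_bigr => g _; rewrite /bernoulli_pmf /=.
by case: (g \in U) => /=; ring.
Qed.

Lemma bexp_blocks p (D A B C : {set {set V}}) (a b c : R) :
    D \subset E -> A \subset E -> B \subset E -> C \subset E ->
    [disjoint D & A] -> [disjoint D & B] -> [disjoint D & C] ->
    [disjoint A & B] -> [disjoint A & C] -> [disjoint B & C] ->
  bexp p (fun S => (D \subset S)%:R *
     (a ^+ #|A :&: S| * (b ^+ #|B :&: S| * c ^+ #|C :&: S|))) =
  \prod_(g in D) p g * (\prod_(g in A) (1 - (1 - a) * p g) *
   (\prod_(g in B) (1 - (1 - b) * p g) * \prod_(g in C) (1 - (1 - c) * p g))).
Proof.
move=> DE AE BE CE dDA dDB dDC dAB dAC dBC.
have prod_subset (X : {set {set V}}) (F : {set V} -> R) : X \subset E ->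
    \prod_(g in X) F g = \prod_(g in E) (if g \in X then F g else 1).
  move=> XE; rewrite [RHS]big_mkcond [LHS]big_mkcond; apply: eq_bigr => g _.
  case gX: (g \in X); first by rewrite (subsetP XE).
  by case: ifP.
have powE (X S : {set {set V}}) (u : R) : X \subset E ->
    u ^+ #|X :&: S| = \prod_(g in E) (if (g \in X) && (g \in S) then u else 1).
  move=> XE; rewrite -prodr_const [LHS]big_mkcond [RHS]big_mkcond.
  apply: eq_bigr => g _; rewrite inE.
  case gX: (g \in X); first by rewrite (subsetP XE).
  by case: ifP.
have DS S : (D \subset S)%:R = \prod_(g in E) (if g \in D then (g \in S)%:R else 1) :> R.
  rewrite -prod_subset //; have [DS|/subsetPn[g gD gS]] := boolP (D \subset S).
    by rewrite big1 // => g /(subsetP DS) ->.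
  by rewrite (bigD1 g) //= (negPf gS) mul0r.
pose phi (g : {set V}) (t : bool) : R := (if g \in D then t%:R else 1) *
     ((if (g \in A) && t then a else 1) *
     ((if (g \in B) && t then b else 1) *
      (if (g \in C) && t then c else 1))).
transitivity (bexp p (fun S => \prod_(g in E) phi g (g \in S))).
  by apply: eq_bexp => S; rewrite DS !powE // -!big_split.
rewrite (bexp_prod p phi) (prod_subset D) // (prod_subset A) // (prod_subset B) //.
rewrite (prod_subset C) // -!big_split; apply: eq_bigr => g _ /=.
rewrite /phi.
have nd (X Y : {set {set V}}) : [disjoint X & Y] -> g \in X -> (g \in Y) = false.
  by move=> /disjointFr; apply.
case gD: (g \in D).
  by rewrite (nd _ _ dDA) // (nd _ _ dDB) // (nd _ _ dDC) //=; ring.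
case gA: (g \in A).
  by rewrite (nd _ _ dAB) // (nd _ _ dAC) //=; ring.
case gB: (g \in B); first by rewrite (nd _ _ dBC) //=; ring.
by case: (g \in C) => /=; ring.
Qed.

End BernoulliExpectation.

Section RandomOrder.
Variable T : finType.
Implicit Types (s t : seq T) (U : {set T}) (c : seq (T * {set T})).

Definition first_in s x U := [forall g in U, index x s <= index g s]%N.

Fixpoint nested_chain c : bool :=
  if c is (x, U) :: c' then
    [&& x \in U, nested_chain c' & all (fun yW : T * {set T} => yW.2 \subset U :\ x) c']
  else true.

Lemma nested_chain_mem c : nested_chain c -> all (fun xU : T * {set T} => xU.1 \in xU.2) c.
Proof.
by elim: c => [|[x U] c ih] //= /and3P[xU /ih -> _]; rewrite xU.
Qed.

Lemma first_in_cons y s x U : x \in U -> y \notin U ->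
  first_in (y :: s) x U = first_in s x U.
Proof.
move=> xU yU; apply: eq_forallb => g /=; case gU: (g \in U) => //=.
have ne z : z \in U -> (y == z) = false.
  by move=> zU; apply: contraNF yU => /eqP ->.
by rewrite !ne // ltnS.
Qed.

Lemma all_first_in_cons y s c : all (fun xU : T * {set T} => xU.1 \in xU.2) c ->
    all (fun xU : T * {set T} => y \notin xU.2) c ->
  all (fun xU => first_in (y :: s) xU.1 xU.2) c =
  all (fun xU => first_in s xU.1 xU.2) c.
Proof.
move=> /allP cmem /allP cy; apply: eq_in_all => -[x U] xUc.
by apply: first_in_cons; [apply: (cmem _ xUc) | apply: (cy _ xUc)].
Qed.

(* In a uniformly random order the minimum of U is uniform on U and independent
   of the relative order of U minus its minimum. *)
Lemma count_nested_chain s c : uniq s -> nested_chain c ->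
    all (fun xU : T * {set T} => xU.2 \subset s) c ->
  ((\sum_(t <- permutations s) all (fun xU => first_in t xU.1 xU.2) c) *
   \prod_(xU <- c) #|xU.2|)%N = (size s)`!.
Proof.
elim: {s}(size s) {-2}s c (erefl (size s)) => [|n ih] s c sz us nc cs.
  move/eqP/nilP: sz => sz; subst s.
  case: c nc cs => [_ _|[x U] c /= /and3P[xU _ _] /andP[/subsetP Us _]].
    by rewrite /= big_nil muln1 big_cons big_nil.
  by have := Us _ xU.
case: c nc cs => [_ _|[x U] c nc cs].
  by rewrite big_nil muln1 sum1_size size_permutations.
have := nc => /= /and3P[xU nc' cU].
have := cs => /= /andP[Us cs'].
rewrite (perm_big _ (permutationsE _)) ?sz // undup_id // big_allpairs_dep /=.
have term y : y \in s ->
    ((\sum_(t <- permutations (rem y s))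
       all (fun xU => first_in (y :: t) xU.1 xU.2) ((x, U) :: c)) *
     \prod_(xU <- (x, U) :: c) #|xU.2| = n`! * ((y \notin U) + #|U| * (y == x)))%N.
  move=> ys; have szr : size (rem y s) = n by rewrite size_rem // sz.
  have ur : uniq (rem y s) by rewrite rem_uniq.
  have sub_rem (W : {set T}) : W \subset s -> y \notin W -> W \subset rem y s.
    move=> Ws yW; apply/subsetP => z zW.
    rewrite mem_rem_uniq // inE (subsetP Ws) // andbT.
    by apply: contraNneq yW => <-.
  have cmem := nested_chain_mem nc.
  have [yU|yU] := boolP (y \in U); last first.
    have -> : (y == x) = false by apply: contraNF yU => /eqP ->.
    have ynot : all (fun xU : T * {set T} => y \notin xU.2) ((x, U) :: c).
      rewrite /= yU; apply/allP => zW zWc; apply: contra yU => yW.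
      by have := subsetP (allP cU _ zWc) _ yW; rewrite inE => /andP[].
    under eq_bigr => t _ do rewrite all_first_in_cons //.
    rewrite muln0 addn0 muln1 -szr; apply: ih => //.
    apply/allP => zW zWc; apply: sub_rem; first exact: (allP cs).
    exact: (allP ynot).
  have [yx|yx] := eqVneq y x; last first.
    rewrite muln0 addn0 muln0 big1 // => t _ /=.
    rewrite [first_in _ _ _](_ : _ = false) //.
    apply/negP => /forallP /(_ y); rewrite yU /= eqxx.
    by rewrite (negPf yx).
  subst y; rewrite add0n muln1 big_cons mulnCA mulnC; congr muln.
  have ynot : all (fun xU : T * {set T} => x \notin xU.2) c.
    apply/allP => zW zWc; apply/negP => xW.
    by have := subsetP (allP cU _ zWc) _ xW; rewrite !inE eqxx.
  have cmem' : all (fun xU : T * {set T} => xU.1 \in xU.2) c by move: cmem => /= /andP[].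
  rewrite -szr -(ih (rem x s) c) //; last first.
    apply/allP => zW zWc; apply: sub_rem; first exact: (allP cs').
    exact: (allP ynot).
  congr muln; apply: eq_bigr => t _ /=.
  rewrite all_first_in_cons // andb_idl // => _.
  by apply/forallP => z; rewrite /= eqxx implybT.
rewrite big_distrl /= big_seq (eq_bigr _ term) -big_seq -big_distrr /=.
have sum_count (P : pred T) : (\sum_(y <- s) P y = count P s)%N.
  by rewrite -sum1_count [RHS]big_mkcond; apply: eq_bigr => y _; case: (P y).
rewrite big_split /= -big_distrr /= !sum_count count_uniq_mem //.
rewrite (subsetP Us) // muln1.
have -> : #|U| = count (mem U) s.
  rewrite -size_filter -(card_uniqP (filter_uniq _ us)); apply: eq_card => y.
  by rewrite mem_filter andb_idr // => /(subsetP Us).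
by rewrite addnC count_predC sz factS mulnC.
Qed.

End RandomOrder.

Section Algorithm.
Variables (V : finType) (act att : {set {set V}}).
Implicit Types (s : seq {set V}) (f g : {set V}) (M : {set {set V}}).

Notation rom s := (attenuate_rom s act att).

Lemma attenuate_rom_rcons s f : rom (rcons s f) =
  if [&& f \in act, f \in att & [forall v in f, ~~ covered (rom s) v]]
  then f |: rom s else rom s.
Proof. by rewrite /attenuate_rom foldl_rcons. Qed.

Lemma uncoveredP M f :
  reflect {in M, forall g, [disjoint g & f]} [forall v in f, ~~ covered M v].
Proof.
apply: (iffP forall_inP) => [h g gM|h v vf].
  rewrite disjoint_sym disjoint_subset; apply/subsetP => v vf; apply/negP => vg.
  by case/negP: (h v vf); apply/existsP; exists g; rewrite gM.
apply/negP => /existsP[g /andP[gM vg]].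
by rewrite (disjointFr (h g gM) vg) in vf.
Qed.

Lemma attenuate_rom_sub s f : f \in rom s -> f \in s.
Proof.
elim/last_ind: s f => [|s g ih] f; first by rewrite inE.
rewrite attenuate_rom_rcons mem_rcons inE.
case: ifP => _; last by move=> /ih ->; rewrite orbT.
by rewrite !inE => /predU1P[->|/ih ->]; rewrite ?eqxx ?orbT.
Qed.

Lemma mem_attenuate_rom s f : uniq s -> f \in s ->
  (f \in rom s) <-> (f \in act :&: att /\
    forall g, g \in rom s -> (index g s < index f s)%N -> [disjoint g & f]).
Proof.
elim/last_ind: s f => [|s e ih] f //.
rewrite rcons_uniq mem_rcons inE => /andP[es us].
have idx g : g \in s -> index g (rcons s e) = index g s.
  by move=> gs; rewrite -cats1 index_cat gs.
have idxe : index e (rcons s e) = size s.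
  by rewrite -cats1 index_cat (negPf es) /= eqxx addn0.
have romE g : g \in s -> (g \in rom (rcons s e)) = (g \in rom s).
  move=> gs; rewrite attenuate_rom_rcons; case: ifP => // _.
  by rewrite !inE; case: eqP => // ge; move: gs es; rewrite ge => ->.
have rom_cases g : g \in rom (rcons s e) -> g = e \/ g \in rom s.
  rewrite attenuate_rom_rcons; case: ifP => _; last by right.
  by rewrite !inE => /predU1P.
move=> /predU1P[->{f}|fs].
  split=> [|[]].
    move=> er; have /and3P[e1 e2 /uncoveredP unc] :
        [&& e \in act, e \in att & [forall v in e, ~~ covered (rom s) v]].
      move: er; rewrite attenuate_rom_rcons; case: ifP => // _ er.
      by rewrite (attenuate_rom_sub er) in es.
    split=> [|g gr]; first by rewrite inE e1.
    by case: (rom_cases _ gr) => [->|gr' _]; [rewrite ltnn | apply: unc].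
  rewrite inE => /andP[e1 e2] h; rewrite attenuate_rom_rcons e1 e2 /=.
  case: ifP => [_|/negP[]]; first by rewrite !inE eqxx.
  apply/uncoveredP => g gr; have gs := attenuate_rom_sub gr.
  by apply: h; rewrite ?romE // idxe idx // index_mem.
rewrite romE //; split=> [/(ih _ us fs)[-> h]|[fR h]].
  split=> // g /rom_cases [->|gr].
    by rewrite idxe idx // => /leq_trans /(_ (index_size _ _)); rewrite ltnn.
  have gs := attenuate_rom_sub gr.
  by rewrite !idx //; apply: h.
apply/(ih _ us fs); split=> // g gr.
have gs := attenuate_rom_sub gr.
by rewrite -(idx g) // -(idx f) //; apply: h; rewrite romE.
Qed.

End Algorithm.

Section SelectionEvents.
Variables (V : finType) (E : {set {set V}}).
Implicit Types (e f g h : {set V}) (s : seq {set V}) (Q : {set {set V}}).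

Definition nbr f := [set g in E | (g != f) && ~~ [disjoint g & f]].

(* For e = uv and f = uw these are the edges at w disjoint from e; rivals1,
   rivals2 and rivals3 are the edges that have to arrive after e, f and h in the
   event that h blocks f and f is the only edge that could have blocked e. *)
Definition blockers e f := [set h in nbr f | (h \notin nbr e) && (h != e)].
Definition rivals1 e f := nbr e :\ f.
Definition rivals2 e f h := blockers e f :\ h.
Definition rivals3 e f h := nbr h :\: (nbr e :|: nbr f).

Lemma nbr_sym e f : e \in E -> f \in E -> (e \in nbr f) = (f \in nbr e).
Proof. by move=> eE fE; rewrite !inE eE fE eq_sym disjoint_sym. Qed.

Lemma nbr_irr e : e \notin nbr e.
Proof. by rewrite inE eqxx andbF. Qed.

Definition chain1 e Q := [:: (e, e |: (nbr e :&: Q))].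

Definition set1c e f Q := e |: (rivals1 e f :&: Q).
Definition set2c e f h Q := f |: (rivals2 e f h :&: Q) :|: set1c e f Q.
Definition set3c e f h Q := h |: (rivals3 e f h :&: Q) :|: set2c e f h Q.

Definition chain3 e f h Q :=
  [:: (h, set3c e f h Q); (f, set2c e f h Q); (e, set1c e f Q)].

Definition run_first s (c : seq ({set V} * {set {set V}})) :=
  all (fun xU : {set V} * {set {set V}} => first_in s xU.1 xU.2) c.

Lemma first_inP s e Q g : first_in s e Q -> g \in Q ->
  (index e s <= index g s)%N.
Proof. by move=> /forall_inP h /h. Qed.

Variables (s : seq {set V}) (act att : {set {set V}}).
Hypotheses (us : uniq s) (sE : s =i E).
Let Q := act :&: att.

Lemma rom_subQ g : g \in attenuate_rom s act att -> g \in Q.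
Proof.
by move=> gr; case/(mem_attenuate_rom act att us (attenuate_rom_sub gr)): (gr).
Qed.

Lemma lt_index g e : g \in E -> (index g s <= index e s)%N -> g != e ->
  (index g s < index e s)%N.
Proof.
move=> gE; rewrite leq_eqVlt => /predU1P[ge|//].
have gs : g \in s by rewrite sE.
have es : e \in s by rewrite -index_mem -ge index_mem.
by rewrite -(nth_index e gs) ge nth_index // eqxx.
Qed.

Lemma chain1_selected e : e \in E -> e \in Q -> run_first s (chain1 e Q) ->
  e \in attenuate_rom s act att.
Proof.
move=> eE eQ /andP[/= fe _].
apply/(mem_attenuate_rom act att us); rewrite ?sE //; split=> // g gr ge.
have gE : g \in E by rewrite -sE; apply: attenuate_rom_sub gr.
apply/negPn/negP => ngd.
suff gN : g \in e |: (nbr e :&: Q) by have := first_inP fe gN; rewrite leqNgt ge.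
rewrite in_setU1 in_setI (rom_subQ gr) inE gE ngd !andbT.
by case: eqVneq.
Qed.

Lemma chain3_before e f h : run_first s (chain3 e f h Q) ->
  [/\ (index h s <= index f s)%N, (index f s <= index e s)%N,
      {in rivals1 e f :&: Q, forall g, index e s <= index g s}%N,
      {in rivals2 e f h :&: Q, forall g, index f s <= index g s}%N &
      {in rivals3 e f h :&: Q, forall g, index h s <= index g s}%N].
Proof.
rewrite /run_first /= andbT => /and3P[fh ff fe]; split=> [||g gr|g gr|g gr].
- by apply: (first_inP fh); rewrite !in_setU !in_set1 eqxx orbT.
- by apply: (first_inP ff); rewrite !in_setU !in_set1 eqxx orbT.
- by apply: (first_inP fe); rewrite in_setU gr orbT.
- by apply: (first_inP ff); rewrite !in_setU gr !orbT.
by apply: (first_inP fh); rewrite !in_setU gr !orbT.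
Qed.

Lemma chain3_selected e f h : e \in E -> f \in nbr e -> h \in blockers e f ->
    [set e; f; h] \subset Q -> run_first s (chain3 e f h Q) ->
  e \in attenuate_rom s act att.
Proof.
move=> eE fN hB; rewrite !subUset !sub1set => /andP[/andP[eQ fQ] hQ] ch.
have [hf fe re rf rh] := chain3_before ch.
have := fN; rewrite inE => /and3P[fE fne fde].
have := hB; rewrite !inE => /and3P[/and3P[hE hnf hdf] hNe hne].
have {}hNe : h \notin nbr e by rewrite inE.
have hf' := lt_index hE hf hnf.
have fe' := lt_index fE fe fne.
have romE g : g \in attenuate_rom s act att -> g \in E.
  by move=> gr; rewrite -sE; apply: attenuate_rom_sub gr.
have hr : h \in attenuate_rom s act att.
  apply/(mem_attenuate_rom act att us); rewrite ?sE //; split=> // g gr gh.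
  apply/negPn/negP => ngd; have gE := romE g gr; have gQ := rom_subQ gr.
  have gnh : g != h by apply: contraTneq gh => ->; rewrite ltnn.
  have gnf : g != f by apply: contraTneq gh => ->; rewrite -leqNgt.
  have gne : g != e.
    by apply: contraTneq gh => ->; rewrite -leqNgt (leq_trans hf).
  have gf : ~~ (index f s <= index g s)%N.
    by rewrite -ltnNge (ltn_trans gh).
  case gNe : (g \in nbr e).
    have := re g; rewrite in_setI in_setD1 gQ gnf gNe => /(_ isT).
    by move=> /(leq_trans fe); rewrite (negPf gf).
  case gNf : (g \in nbr f).
    have := rf g; rewrite in_setI gQ in_setD1 gnh inE gNf gNe gne.
    by move=> /(_ isT); rewrite (negPf gf).
  have := rh g; rewrite in_setI gQ in_setD in_setU gNe gNf inE gE gnh ngd.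
  by move=> /(_ isT); rewrite leqNgt gh.
have fr : f \notin attenuate_rom s act att.
  apply/negP => /(mem_attenuate_rom act att us).
  by rewrite sE => /(_ fE) [_ /(_ h hr hf')]; rewrite (negPf hdf).
apply/(mem_attenuate_rom act att us); rewrite ?sE //; split=> // g gr ge.
apply/negPn/negP => ngd.
have gne : g != e by apply: contraTneq ge => ->; rewrite ltnn.
have gnf : g != f by apply: contraTneq gr => ->.
have := re g; rewrite in_setI (rom_subQ gr) in_setD1 gnf inE (romE g gr) gne ngd.
by move=> /(_ isT); rewrite leqNgt ge.
Qed.

Lemma chain1_chain3 e f h : e \in E -> f \in nbr e ->
    [set e; f; h] \subset Q -> run_first s (chain1 e Q) ->
  ~~ run_first s (chain3 e f h Q).
Proof.
move=> eE fN; rewrite !subUset !sub1set => /andP[/andP[_ fQ] _] /andP[/= fe _].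
apply/negP => /chain3_before[_ fe' _ _ _].
have := fN; rewrite inE => /and3P[fE fne _].
have := first_inP fe (g := f); rewrite in_setU1 in_setI fN fQ orbT => /(_ isT).
by rewrite leqNgt lt_index.
Qed.

Lemma chain3_inj e f h f' h' : e \in E -> f \in nbr e -> f' \in nbr e ->
    h \in blockers e f -> h' \in blockers e f' ->
    [set e; f; h] \subset Q -> [set e; f'; h'] \subset Q ->
    run_first s (chain3 e f h Q) -> run_first s (chain3 e f' h' Q) ->
  (f, h) = (f', h').
Proof.
move=> eE fN fN' hB hB'; rewrite !subUset !sub1set.
move=> /andP[/andP[_ fQ] hQ] /andP[/andP[_ fQ'] hQ'] ch ch'.
have [hf fe re rf _] := chain3_before ch.
have [hf' fe' re' rf' _] := chain3_before ch'.
have ff : f = f'.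
  apply/eqP/negPn/negP => ff.
  have := fN'; rewrite inE => /and3P[fE' fne' _].
  have := re f'; rewrite in_setI in_setD1 eq_sym ff fN' fQ' => /(_ isT).
  by rewrite leqNgt lt_index.
subst f'; congr pair; apply/eqP/negPn/negP => hh.
have := hB'; rewrite inE => /andP[]; rewrite inE => /and3P[hE hnf _] _.
have := rf h'; rewrite in_setI in_setD1 eq_sym hh hB' hQ' => /(_ isT).
by rewrite leqNgt lt_index.
Qed.

End SelectionEvents.

Section SelectionProbability.
Variables (R : realType) (V : finType) (E : {set {set V}}).
Implicit Types (e f g h : {set V}) (s : seq {set V}) (Q : {set {set V}}).

Local Notation nbr := (nbr E).
Local Notation rivals1 := (rivals1 E).
Local Notation rivals2 := (rivals2 E).
Local Notation rivals3 := (rivals3 E).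
Local Notation blockers := (blockers E).

Lemma avg_run_first (c : seq ({set V} * {set {set V}})) : nested_chain c ->
    all (fun xU : {set V} * {set {set V}} => xU.2 \subset E) c ->
  \sum_(s <- permutations (enum E))
    (size (permutations (enum E)))%:R^-1 * (run_first s c)%:R =
  \prod_(xU <- c) #|xU.2|%:R^-1 :> R.
Proof.
move=> nc cE.
have cs : all (fun xU : {set V} * {set {set V}} => xU.2 \subset enum E) c.
  by apply: sub_all cE => xU /subsetP UE; apply/subsetP => y /UE; rewrite mem_enum.
have := count_nested_chain (enum_uniq E) nc cs; rewrite -cardE => cnt.
rewrite -mulr_sumr size_permutations ?enum_uniq // -cardE -natr_sum.
have fN0 : #|E|`!%:R != 0 :> R by rewrite pnatr_eq0 -lt0n fact_gt0.
apply: (mulfI fN0); rewrite mulVKf // -{1}cnt natrM -mulrA natr_prod.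
rewrite -big_split /= [X in _ = _ * X]big1_seq ?mulr1 // => xU xUc.
rewrite mulfV // pnatr_eq0 cards_eq0.
apply/set0Pn; exists xU.1; exact: (allP (nested_chain_mem nc)).
Qed.

Lemma sum_indicator_le (I : finType) (P b : pred I) (c : bool) :
    (forall i, P i -> b i -> c) ->
    (forall i j, P i -> P j -> b i -> b j -> i = j) ->
  \sum_(i | P i) (b i)%:R <= c%:R :> R.
Proof.
move=> bc inj; have [/existsP[i /andP[Pi bi]]|] := boolP [exists i, P i && b i].
  rewrite (bc i) // (bigD1 i) //= bi big1 ?addr0 // => j /andP[Pj ji].
  by case bj: (b j) => //; rewrite (inj j i) ?eqxx in ji.
rewrite negb_exists => /forallP nb; rewrite big1 ?ler0n // => i Pi.
by have := nb i; rewrite Pi /= => /negPf ->.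
Qed.

Section FixedEdge.
Variables (e : {set V}) (eE : e \in E).

Lemma blockersP f h : f \in nbr e -> h \in blockers e f ->
  [/\ f \in E, h \in E, f != e, h != e & h != f] /\ h \notin nbr e /\ h \in nbr f.
Proof.
move=> fN; rewrite inE => /and3P[hf hNe he].
have /and3P[fE fe _] : [&& f \in E, f != e & ~~ [disjoint f & e]] by rewrite inE in fN.
by have /and3P[hE hnf _] : [&& h \in E, h != f & ~~ [disjoint h & f]] by rewrite inE in hf.
Qed.

Lemma rivals1_sub f : rivals1 e f \subset E.
Proof. by apply/subsetP => g; rewrite !inE => /and3P[_ ->]. Qed.

Lemma rivals2_sub f h : rivals2 e f h \subset E.
Proof. by apply/subsetP => g; rewrite !inE => /and3P[_ /andP[->]]. Qed.

Lemma rivals3_sub f h : rivals3 e f h \subset E.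
Proof. by apply/subsetP => g; rewrite !inE => /andP[_ /andP[->]]. Qed.

Lemma disjoint_of (A B : {set {set V}}) :
  (forall g, g \in A -> g \in B -> false) -> [disjoint A & B].
Proof.
by move=> h; apply/pred0P => g /=; apply/negP => /andP[gA gB]; have := h g gA gB.
Qed.

Lemma blocks_disjoint f h : f \in nbr e -> h \in blockers e f ->
  let D := [set e; f; h] in
  [/\ [disjoint D & rivals1 e f], [disjoint D & rivals2 e f h],
      [disjoint D & rivals3 e f h] &
    [/\ [disjoint rivals1 e f & rivals2 e f h],
        [disjoint rivals1 e f & rivals3 e f h] &
        [disjoint rivals2 e f h & rivals3 e f h]]].
Proof.
move=> fN hB D.
have [[fE hE fe he hf] [hNe hNf]] := blockersP fN hB.
have eNh : e \notin nbr h by rewrite nbr_sym.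
have i1 := nbr_irr E e; have i2 := nbr_irr E f; have i3 := nbr_irr E h.
split; last split.
- apply: disjoint_of => g; rewrite !(in_setU, in_set1) => /orP[/orP[]|] /eqP ->.
  + by rewrite in_setD1 (negPf i1) andbF.
  + by rewrite in_setD1 eqxx.
  + by rewrite in_setD1 (negPf hNe) andbF.
- apply: disjoint_of => g; rewrite !(in_setU, in_set1) => /orP[/orP[]|] /eqP ->.
  + by rewrite in_setD1 inE eqxx !andbF.
  + by rewrite in_setD1 inE (negPf i2) !andbF.
  + by rewrite in_setD1 eqxx.
- apply: disjoint_of => g; rewrite !(in_setU, in_set1) => /orP[/orP[]|] /eqP ->.
  + by rewrite in_setD (negPf eNh) andbF.
  + by rewrite in_setD in_setU fN.
  + by rewrite in_setD (negPf i3) andbF.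
- apply: disjoint_of => g; rewrite in_setD1 => /andP[_ gN].
  by rewrite in_setD1 inE gN !andbF.
- apply: disjoint_of => g; rewrite in_setD1 => /andP[_ gN].
  by rewrite in_setD in_setU gN.
apply: disjoint_of => g; rewrite in_setD1 inE => /andP[_ /andP[gN _]].
by rewrite in_setD in_setU gN orbT.
Qed.

Lemma card_chain1 Q : #|e |: (nbr e :&: Q)| = #|nbr e :&: Q|.+1.
Proof. by rewrite cardsU1 in_setI (negPf (nbr_irr E e)) add1n. Qed.

Lemma cardsU_disjoint (A B : {set {set V}}) : [disjoint A & B] ->
  #|A :|: B| = (#|A| + #|B|)%N.
Proof. by move=> /disjoint_setI0; rewrite cardsU => ->; rewrite cards0 subn0. Qed.

Lemma chain3_cards f h Q : f \in nbr e -> h \in blockers e f ->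
  [/\ #|set1c E e f Q| = (#|rivals1 e f :&: Q| + 1)%N,
      #|set2c E e f h Q| = (#|rivals1 e f :&: Q| + #|rivals2 e f h :&: Q| + 2)%N,
      #|set3c E e f h Q| = (#|rivals1 e f :&: Q| + #|rivals2 e f h :&: Q|
                            + #|rivals3 e f h :&: Q| + 3)%N,
      f \notin set1c E e f Q & h \notin set2c E e f h Q].
Proof.
move=> fN hB.
have [[fE hE fe he hf] [hNe hNf]] := blockersP fN hB.
have [dD1 dD2 dD3 [d12 d13 d23]] := blocks_disjoint fN hB.
have D1 g : g \in [set e; f; h] -> (g \in rivals1 e f) = false by apply: disjointFr.
have D2 g : g \in [set e; f; h] -> (g \in rivals2 e f h) = false by apply: disjointFr.
have D3 g : g \in [set e; f; h] -> (g \in rivals3 e f h) = false by apply: disjointFr.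
have eD : e \in [set e; f; h] by rewrite !inE eqxx.
have fD : f \in [set e; f; h] by rewrite !inE eqxx orbT.
have hD : h \in [set e; f; h] by rewrite !inE eqxx orbT.
have I1 g : (g \in set1c E e f Q) = (g == e) || ((g \in rivals1 e f) && (g \in Q)).
  by rewrite in_setU1 in_setI.
have I2 g : (g \in set2c E e f h Q) =
    [|| g == f, (g \in rivals2 e f h) && (g \in Q) | g \in set1c E e f Q].
  by rewrite in_setU in_setU1 in_setI orbA.
have f1 : f \notin set1c E e f Q by rewrite I1 D1 // (negPf fe).
have h2 : h \notin set2c E e f h Q.
  by rewrite I2 I1 D1 // D2 // (negPf hf) (negPf he).
have c1 : #|set1c E e f Q| = (#|rivals1 e f :&: Q| + 1)%N.
  by rewrite cardsU1 in_setI D1 // addnC.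
have c2 : #|set2c E e f h Q| = (#|rivals1 e f :&: Q| + #|rivals2 e f h :&: Q| + 2)%N.
  rewrite cardsU_disjoint; last first.
    apply: disjoint_of => g; rewrite in_setU1 I1 in_setI.
    move=> /orP[/eqP ->|/andP[g2 gQ]]; first by rewrite D1 // (negPf fe).
    move=> /orP[/eqP ge|]; first by rewrite ge D2 in g2.
    by rewrite (disjointFl d12 g2).
  by rewrite c1 cardsU1 in_setI D2 //=; clear; lia.
split=> //; rewrite cardsU_disjoint.
  by rewrite c2 cardsU1 in_setI D3 //=; clear; lia.
apply: disjoint_of => g; rewrite in_setU1 I2 I1 in_setI.
move=> /orP[/eqP ->|/andP[g3 gQ]]; first by rewrite D1 // D2 // (negPf hf) (negPf he).
rewrite (disjointFl d13 g3) (disjointFl d23 g3) /= orbF.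
by move=> /orP[/eqP|/eqP] ge; rewrite ge D3 in g3.
Qed.

Lemma avg_chain3 f h Q : f \in nbr e -> h \in blockers e f ->
  \sum_(s <- permutations (enum E))
    (size (permutations (enum E)))%:R^-1 * (run_first s (chain3 E e f h Q))%:R =
  ((#|rivals1 e f :&: Q| + 1)%:R * (#|rivals1 e f :&: Q| + #|rivals2 e f h :&: Q| + 2)%:R
   * (#|rivals1 e f :&: Q| + #|rivals2 e f h :&: Q| + #|rivals3 e f h :&: Q| + 3)%:R)^-1
  :> R.
Proof.
move=> fN hB; have [c1 c2 c3 f1 h2] := chain3_cards Q fN hB.
have [[fE hE _ _ _] _] := blockersP fN hB.
have s1E : set1c E e f Q \subset E.
  by rewrite subUset sub1set eE subIset // rivals1_sub.
have s2E : set2c E e f h Q \subset E.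
  by rewrite subUset s1E andbT subUset sub1set fE subIset // rivals2_sub.
have s3E : set3c E e f h Q \subset E.
  by rewrite subUset s2E andbT subUset sub1set hE subIset // rivals3_sub.
have s12 : set1c E e f Q \subset set2c E e f h Q by apply: subsetUr.
have s23 : set2c E e f h Q \subset set3c E e f h Q by apply: subsetUr.
rewrite avg_run_first.
- by rewrite !big_cons big_nil /= c1 c2 c3 !invfM mulr1; ring.
- have e1 : e \in set1c E e f Q by rewrite in_setU1 eqxx.
  have f2 : f \in set2c E e f h Q by rewrite in_setU in_setU1 eqxx.
  have h3 : h \in set3c E e f h Q by rewrite in_setU in_setU1 eqxx.
  have h1 : h \notin set1c E e f Q by apply: contra h2 => /(subsetP s12).
  by rewrite /= !subsetD1 s12 s23 (subset_trans s12 s23) f1 h2 h1 e1 f2 h3.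
by rewrite /= s1E s2E s3E.
Qed.

(* The probability, given the set Q of active and not attenuated edges, that e
   precedes its rivals or that some h blocks the only rival f preceding e. *)
Definition chain_weight Q : R :=
  ([set e] \subset Q)%:R * (#|nbr e :&: Q|.+1%:R)^-1 +
  \sum_(f in nbr e) \sum_(h in blockers e f) ([set e; f; h] \subset Q)%:R *
    ((#|rivals1 e f :&: Q| + 1)%:R *
     (#|rivals1 e f :&: Q| + #|rivals2 e f h :&: Q| + 2)%:R *
     (#|rivals1 e f :&: Q| + #|rivals2 e f h :&: Q| + #|rivals3 e f h :&: Q| + 3)%:R)^-1.

Lemma selection_prob_ge (x : {set V} -> R) (a : R -> R) :
    (forall f, f \in E -> 0 <= x f <= 1) ->
    (forall f, f \in E -> 0 <= a (x f) <= 1) ->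
  bexp E (fun f => x f * a (x f)) chain_weight <= selection_prob E x a e.
Proof.
move=> x01 a01.
rewrite -(bexp_setI E x (fun f => a (x f))) /selection_prob.
under [leRHS]eq_bigr => s _.
  rewrite mulr_sumr; under eq_bigr => act _ do rewrite mulr_sumr.
  over.
rewrite [leRHS]exchange_big /=; apply: ler_sum => act _.
rewrite [leRHS]exchange_big /= /bexp mulr_sumr; apply: ler_sum => att _.
have B0 (p : {set V} -> R) S : (forall f, f \in E -> 0 <= p f <= 1) ->
    0 <= bernoulli_set E p S.
  by move=> p01; apply: prodr_ge0 => f fE; apply: bernoulli_pmf_ge0; apply: p01.
under [leRHS]eq_bigr => s _ do
  rewrite [_%:R^-1 * _]mulrCA.
rewrite -mulr_sumr mulrA; apply: ler_wpM2l; first by rewrite mulr_ge0 ?B0.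
set Q := act :&: att; rewrite /chain_weight.
have -> : (#|nbr e :&: Q|.+1%:R)^-1 = \sum_(s <- permutations (enum E))
    (size (permutations (enum E)))%:R^-1 * (run_first s (chain1 E e Q))%:R :> R.
  rewrite avg_run_first; first by rewrite big_cons big_nil mulr1 /= card_chain1.
    by rewrite /= in_setU1 eqxx.
  rewrite /= andbT subUset sub1set eE subIset //.
  by apply/orP; left; apply/subsetP => g; rewrite inE => /andP[].
set N := (size (permutations (enum E)))%:R^-1 : R.
have -> : \sum_(f in nbr e) \sum_(h in blockers e f) ([set e; f; h] \subset Q)%:R *
    ((#|rivals1 e f :&: Q| + 1)%:R *
     (#|rivals1 e f :&: Q| + #|rivals2 e f h :&: Q| + 2)%:R *
     (#|rivals1 e f :&: Q| + #|rivals2 e f h :&: Q| + #|rivals3 e f h :&: Q| + 3)%:R)^-1 =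
  \sum_(s <- permutations (enum E)) N * \sum_(f in nbr e) \sum_(h in blockers e f)
    (([set e; f; h] \subset Q) && run_first s (chain3 E e f h Q))%:R :> R.
  under [RHS]eq_bigr => s _ do rewrite mulr_sumr.
  rewrite [RHS]exchange_big /=; apply: eq_bigr => f fN.
  under [RHS]eq_bigr => s _ do rewrite mulr_sumr.
  rewrite [RHS]exchange_big /=; apply: eq_bigr => h hB.
  rewrite -(avg_chain3 Q fN hB) mulr_sumr; apply: eq_bigr => s _.
  by rewrite mulrCA -natrM mulnb.
rewrite mulr_sumr -big_split /= big_seq [leRHS]big_seq.
apply: ler_sum => s; rewrite mem_permutations => pE.
have us : uniq s by rewrite (perm_uniq pE) enum_uniq.
have sE : s =i E by move=> g; rewrite (perm_mem pE) mem_enum.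
rewrite mulrCA -natrM mulnb -mulrDr; apply: ler_wpM2l; first by rewrite invr_ge0 ler0n.
rewrite pair_big_dep /=.
have [/andP[eQ run]|_] := boolP (_ && _).
  rewrite sub1set in eQ.
  rewrite (chain1_selected us sE eE eQ run) big1 ?addr0 // => -[f h] /= /andP[fN hB].
  apply/eqP; rewrite pnatr_eq0 eqb0; apply/negP => /andP[DQ ch].
  by have := chain1_chain3 sE eE fN DQ run; rewrite /run_first /= ch.
rewrite add0r; apply: sum_indicator_le => [[f h]|[f h] [f' h']] /=.
  by move=> /andP[fN hB] /andP[DQ ch]; apply: (chain3_selected us sE eE fN hB DQ ch).
move=> /andP[fN hB] /andP[fN' hB'] /andP[DQ ch] /andP[DQ' ch'].
exact: (chain3_inj sE eE fN fN' hB hB' DQ DQ' ch ch').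
Qed.

End FixedEdge.
End SelectionProbability.

(** * Mass computations in a 1-regular graph *)

Section RegularGraph.
Variables (R : realType) (V : finType) (E : {set {set V}}) (x : {set V} -> R).
Hypotheses (hE : simple_graph E) (hx : one_regular E x).
Implicit Types (e f g h : {set V}) (u v w : V).

Local Notation nbr := (nbr E).
Local Notation blockers := (blockers E).

Lemma x_itv f : f \in E -> 0 <= x f <= 1.
Proof. by case: hx => -[h _] _; apply: h. Qed.

Lemma x_ge0 f : f \in E -> 0 <= x f.
Proof. by move=> /x_itv/andP[]. Qed.

Lemma degree_sum v : \sum_(g in E | v \in g) x g = 1.
Proof.
by case: hx => _ /(_ v) <-; apply: eq_bigl => g; rewrite inE.
Qed.

Lemma edge_eq g u v : g \in E -> u != v -> u \in g -> v \in g -> g = [set u; v].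
Proof.
move=> gE uv ug vg; apply/esym/eqP; rewrite eqEcard subUset !sub1set ug vg.
by rewrite (hE gE) cards2 uv.
Qed.

Lemma edgeP e : e \in E -> exists u v, u != v /\ e = [set u; v].
Proof. by move=> eE; apply/cards2P; rewrite hE. Qed.

Lemma in_nbr e u v g : e = [set u; v] -> g \in E ->
  (g \in nbr e) = (g != e) && ((u \in g) || (v \in g)).
Proof.
move=> eE gE; rewrite inE gE /=; congr (_ && _).
rewrite eE -setI_eq0; apply/idP/orP => [/set0Pn[w]|[ug|vg]]; last 2 first.
- by apply/set0Pn; exists u; rewrite !inE eqxx ug.
- by apply/set0Pn; exists v; rewrite !inE eqxx orbT vg.
by rewrite !inE => /andP[wg /orP[/eqP <-|/eqP <-]]; [left | right].
Qed.

Lemma sum_indicator (P : pred {set V}) (F : {set V} -> R) :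
  \sum_(g in E | P g) F g = \sum_(g in E) (P g)%:R * F g.
Proof.
rewrite big_mkcondr; apply: eq_bigr => g _.
by case: (P g); rewrite ?mul1r ?mul0r.
Qed.

Lemma nbr_sub_sum (S : {set {set V}}) (F : {set V} -> R) : S \subset E ->
  \sum_(g in S) F g = \sum_(g in E) (g \in S)%:R * F g.
Proof.
move=> SE; rewrite -sum_indicator; apply: eq_bigl => g.
by rewrite andbC andb_idr // => /(subsetP SE).
Qed.

Lemma sum_nbr e : e \in E -> \sum_(g in nbr e) x g = 2 - 2 * x e.
Proof.
move=> eE; have [u [v [uv eUV]]] := edgeP eE.
have -> : \sum_(g in nbr e) x g =
  \sum_(g in E) (((u \in g)%:R + (v \in g)%:R) * x g - 2 * (g == e)%:R * x g).
  rewrite nbr_sub_sum; last by apply/subsetP => g; rewrite inE => /andP[].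
  apply: eq_bigr => g gE; rewrite (in_nbr eUV gE).
  have [->|ge] := eqVneq g e; first by rewrite eUV !inE !eqxx orbT /=; ring.
  case ug: (u \in g); case vg: (v \in g) => /=; rewrite ?mulr0n; try ring.
  by rewrite (edge_eq gE uv ug vg) eUV eqxx in ge.
rewrite big_split /= sumrN; congr (_ - _).
  under eq_bigr => g _ do rewrite mulrDl.
  by rewrite big_split /= -!sum_indicator !degree_sum; ring.
under eq_bigr => g _ do rewrite -mulrA.
rewrite -mulr_sumr -sum_indicator (big_pred1 e) // => g /=.
by rewrite andbC andb_idr // => /eqP ->.
Qed.

Lemma nbr_cases e f : e \in E -> f \in nbr e ->
  exists u v w, [/\ e = [set u; v], f = [set u; w], u != v, u != w & v != w].
Proof.
move=> eE fN; have fE : f \in E by move: fN; rewrite inE => /andP[].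
have [u [v [uv eUV]]] := edgeP eE.
have := fN; rewrite (in_nbr eUV fE) => /andP[fe uvf].
have other (a b : V) : e = [set a; b] -> a != b -> a \in f ->
    exists w, [/\ f = [set a; w], a != w & b != w].
  move=> eab ab af; have [c [d [cd fcd]]] := edgeP fE.
  have [w [fw aw]] : exists w, f = [set a; w] /\ a != w.
    move: af; rewrite fcd !inE => /orP[/eqP ->|/eqP ->]; first by exists d.
    by exists c; rewrite setUC eq_sym.
  exists w; split=> //; apply: contraNneq fe => bw.
  by rewrite fw eab bw.
case/orP: uvf => [uf|vf].
  by have [w [fw uw vw]] := other u v eUV uv uf; exists u, v, w.
have eVU : e = [set v; u] by rewrite setUC.
have vu : v != u by rewrite eq_sym.
by have [w [fw vw uw]] := other v u eVU vu vf; exists v, u, w.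
Qed.

(* For e = uv and f = uw this is vw, the third side of the triangle. *)
Definition partner e f : {set V} := (e :\: f) :|: (f :\: e).

Lemma partnerK e : involutive (partner e).
Proof.
by move=> f; apply/setP => v; rewrite !inE; case: (v \in e); case: (v \in f).
Qed.

Lemma partnerE e f u v w : e = [set u; v] -> f = [set u; w] ->
  u != v -> u != w -> v != w -> partner e f = [set v; w].
Proof.
move=> -> -> uv uw vw; apply/setP => y; rewrite !inE.
have [->|yu] := eqVneq y u; first by rewrite (negPf uv) (negPf uw).
have [->|yv] := eqVneq y v; first by rewrite (negPf vw).
by case: (y == w).
Qed.

Definition partner_mass e f : R := if partner e f \in E then x (partner e f) else 0.

Lemma partner_mass_ge0 e f : 0 <= partner_mass e f.
Proof. by rewrite /partner_mass; case: ifP => // /x_ge0. Qed.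

Lemma sum_partner_sq e : e \in E ->
  \sum_(f in nbr e) partner_mass e f ^+ 2 <= \sum_(f in nbr e) x f ^+ 2.
Proof.
move=> eE.
have -> : \sum_(f in nbr e) partner_mass e f ^+ 2 =
    \sum_(f | (f \in nbr e) && (partner e f \in nbr e)) x (partner e f) ^+ 2.
  rewrite big_mkcondr; apply: eq_bigr => f fN.
  have [u [v [w [eUV fUW uv uw vw]]]] := nbr_cases eE fN.
  rewrite /partner_mass (partnerE eUV fUW uv uw vw).
  have [pE|pE] := boolP ([set v; w] \in E); last first.
    by rewrite inE (negPf pE) expr0n.
  rewrite (in_nbr eUV pE) !inE eqxx orbT andbT eUV.
  case: eqP => // /setP/(_ w); rewrite !inE eqxx orbT.
  by rewrite eq_sym (negPf uw) eq_sym (negPf vw).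
rewrite (reindex_inj (inv_inj (partnerK e))) /=.
rewrite [leRHS](bigID [pred f | partner e f \in nbr e]) /=.
under eq_bigl => f do rewrite partnerK andbC.
under eq_bigr => f _ do rewrite partnerK.
by rewrite lerDl; apply: sumr_ge0 => f _; apply: sqr_ge0.
Qed.

Lemma in_blockers e f h u v w : e = [set u; v] -> f = [set u; w] -> v != w ->
    e \in E -> h \in E ->
  (h \in blockers e f) = [&& u \notin h, v \notin h & w \in h].
Proof.
move=> eUV fUW vw eE hE'; rewrite inE (in_nbr fUW hE') (in_nbr eUV hE').
have [uh|uh] /= := boolP (u \in h).
  rewrite andbT; case: (eqVneq h e) => [->|]; by rewrite /= ?andbF.
have [vh|vh] /= := boolP (v \in h).
  by rewrite andbT; case: (eqVneq h e) => [->|]; rewrite /= ?andbF.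
have -> : h != e by apply: contraNneq uh => ->; rewrite eUV !inE eqxx.
have -> : h != f by apply: contraNneq uh => ->; rewrite fUW !inE eqxx.
by rewrite !andbT /= ?andbT.
Qed.

Lemma blockers_sub e f : blockers e f \subset E.
Proof. by apply/subsetP => g; rewrite !inE => /and3P[/andP[]]. Qed.

Lemma sum_blockers e f : e \in E -> f \in nbr e ->
  \sum_(h in blockers e f) x h = 1 - x f - partner_mass e f.
Proof.
move=> eE fN; have fE : f \in E by move: fN; rewrite inE => /andP[].
have [u [v [w [eUV fUW uv uw vw]]]] := nbr_cases eE fN.
have pVW := partnerE eUV fUW uv uw vw.
rewrite -(degree_sum w) sum_indicator nbr_sub_sum ?blockers_sub //.
have -> : x f = \sum_(g in E) (g == f)%:R * x g.
  by rewrite -sum_indicator (big_pred1 f) // => g /=; rewrite andbC andb_idr // => /eqP ->.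
have -> : partner_mass e f = \sum_(g in E) (g == partner e f)%:R * x g.
  rewrite -sum_indicator /partner_mass; case: ifP => pE.
    by rewrite (big_pred1 (partner e f)) // => g /=; rewrite andbC andb_idr // => /eqP ->.
  by rewrite big1 // => g /andP[gE /eqP gp]; rewrite gp pE in gE.
rewrite -!sumrB; apply: eq_bigr => g gE; rewrite (in_blockers eUV fUW vw eE gE) pVW.
have [wg|wg] := boolP (w \in g); last first.
  have -> : (g == f) = false by apply: contraNF wg => /eqP ->; rewrite fUW !inE eqxx orbT.
  have -> : (g == [set v; w]) = false.
    by apply: contraNF wg => /eqP ->; rewrite !inE eqxx orbT.
  by rewrite !andbF /= !mul0r !subr0.
have [ug|ug] := boolP (u \in g).
  have gf : g = f by rewrite fUW; apply: edge_eq.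
  have -> : (g == [set v; w]) = false.
    apply: contraTF ug => /eqP ->; rewrite !inE negb_or uv uw //.
  by rewrite gf eqxx /=; ring.
have -> : (g == f) = false by apply: contraNF ug => /eqP ->; rewrite fUW !inE eqxx.
have [vg|vg] := boolP (v \in g) => /=.
  by rewrite (edge_eq gE vw vg wg) eqxx /= !mul0r mul1r subr0 subrr.
have -> : (g == [set v; w]) = false by apply: contraNF vg => /eqP ->; rewrite !inE eqxx.
by rewrite /= !mul0r mul1r !subr0.
Qed.

Lemma sum_avoiding_le (S : {set {set V}}) w h : h \in E -> w \in h ->
  S \subset [set g in E | (w \in g) && (g != h)] -> \sum_(g in S) x g <= 1 - x h.
Proof.
move=> hE' wh SS; have := degree_sum w; rewrite (bigD1 h) ?hE' //= => D.
suff : \sum_(g in S) x g <= \sum_(g in E | (w \in g) && (g != h)) x g.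
  by move: D; under eq_bigl => g do rewrite -andbA; lra.
rewrite [leRHS](bigID [pred g | g \in S]) /=.
rewrite [X in _ <= X + _](eq_bigl (mem S)) => [|g]; last first.
  by rewrite andb_idl // => /(subsetP SS); rewrite inE.
by rewrite lerDl; apply: sumr_ge0 => g /andP[/andP[gE _] _]; apply: x_ge0.
Qed.

Lemma sum_rivals2 e f h : e \in E -> f \in nbr e -> h \in blockers e f ->
  \sum_(g in rivals2 E e f h) x g <= 1 - x h.
Proof.
move=> eE fN hB; have [u [v [w [eUV fUW uv uw vw]]]] := nbr_cases eE fN.
have hE' := subsetP (blockers_sub e f) _ hB.
have := hB; rewrite (in_blockers eUV fUW vw eE hE') => /and3P[_ _ wh].
apply: (sum_avoiding_le hE' wh); apply/subsetP => g; rewrite in_setD1 => /andP[gh gB].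
have gE := subsetP (blockers_sub e f) _ gB.
move: gB; rewrite (in_blockers eUV fUW vw eE gE) => /and3P[_ _ wg].
by rewrite inE gE wg.
Qed.

Lemma sum_rivals3 e f h : e \in E -> f \in nbr e -> h \in blockers e f ->
  \sum_(g in rivals3 E e f h) x g <= 1 - x h.
Proof.
move=> eE fN hB; have [u [v [w [eUV fUW uv uw vw]]]] := nbr_cases eE fN.
have hE' := subsetP (blockers_sub e f) _ hB.
have := hB; rewrite (in_blockers eUV fUW vw eE hE') => /and3P[_ _ wh].
have [t hWT] : exists t, h = [set w; t].
  have [a [b [ab hab]]] := edgeP hE'; move: wh; rewrite hab !inE.
  by move=> /orP[/eqP ->|/eqP ->]; [exists b | exists a; rewrite setUC].
have th : t \in h by rewrite hWT !inE eqxx orbT.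
apply: (sum_avoiding_le hE' th); apply/subsetP => g; rewrite in_setD in_setU negb_or.
move=> /andP[/andP[gNe gNf] gNh].
have gE : g \in E by move: gNh; rewrite inE => /andP[].
have := gNh; rewrite (in_nbr hWT gE) => /andP[gh wtg].
rewrite inE gE gh andbT.
case/orP: wtg => // wg; move: gNf; rewrite (in_nbr fUW gE) wg orbT andbT negbK.
by move=> /eqP gf; rewrite gf fN in gNe.
Qed.

Lemma adjacent_mass_le e f : e \in E -> f \in nbr e -> x e + x f <= 1.
Proof.
move=> eE fN; have [fE fe] : f \in E /\ f != e.
  by move: fN; rewrite inE => /and3P[].
have [u [v [w [eUV fUW _ _ _]]]] := nbr_cases eE fN.
have ue : u \in e by rewrite eUV !inE eqxx.
have uf : u \in f by rewrite fUW !inE eqxx.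
have := @sum_avoiding_le [set f] u e eE ue; rewrite big_set1 lerBrDl; apply.
by rewrite sub1set inE fE uf.
Qed.

End RegularGraph.

(** * Comparison of iterated integrals *)

Section Comparison.
Variable R : realType.
Implicit Types (f g F G : R -> R).

Lemma le_of_le_deriv F G f g :
    (forall t : R, is_derive t (1 : R) F (f t)) ->
    (forall t : R, is_derive t (1 : R) G (g t)) ->
    F 0 <= G 0 -> (forall t, 0 <= t <= 1 -> f t <= g t) ->
  forall t, 0 <= t <= 1 -> F t <= G t.
Proof.
move=> dF dG FG0 fg t /andP[t0 t1].
have dGF s : is_derive s (1 : R) (G - F) (g s - f s) by exact: is_deriveB.
have dr s : derivable (G - F) s 1 by exact: ex_derive.
suff: (G - F) 0 <= (G - F) t by rewrite !fctE; lra.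
apply: (@ger0_derive1_ndecr R _ 0 1) => // [s|].
  rewrite in_itv /= => /andP[s0 s1].
  by rewrite derive1E derive_val subr_ge0 fg // !ltW.
apply: continuous_subspaceT => s.
by apply/differentiable_continuous/derivable1_diffP.
Qed.

Lemma is_derive_ext f g (t df dg : R) :
  f =1 g -> df = dg -> is_derive t (1 : R) f df -> is_derive t (1 : R) g dg.
Proof. by move=> /funext -> ->. Qed.

Lemma is_derive_bigsum (I : Type) (r : seq I) (P : pred I)
    (F : I -> R -> R) (dF : I -> R) (t : R) :
    (forall i, is_derive t (1 : R) (F i) (dF i)) ->
  is_derive t (1 : R) (fun s => \sum_(i <- r | P i) F i s) (\sum_(i <- r | P i) dF i).
Proof.
move=> h; elim: r => [|i r ih].
  apply: (is_derive_ext (f := cst 0) (df := 0)) => [s|]; rewrite ?big_nil //.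
case Pi: (P i).
  apply: (is_derive_ext (f := F i + fun s => \sum_(j <- r | P j) F j s)
    (df := dF i + \sum_(j <- r | P j) dF j)) => [s|]; rewrite ?big_cons ?Pi //.
by apply: (is_derive_ext _ _ ih) => [s|]; rewrite !big_cons Pi.
Qed.

Lemma is_derive_scale (a : R) F (t df : R) :
  is_derive t (1 : R) F df -> is_derive t (1 : R) (fun s => a * F s) (a * df).
Proof.
move=> h; apply: (is_derive_ext (f := a \*: F) (df := a *: df)) => //.
Qed.

Lemma is_derive_expM (a t : R) :
  is_derive t (1 : R) (fun s => expR (a * s)) (a * expR (a * t)).
Proof.
apply: (is_derive_ext (f := expR \o (a \*: id)) (df := expR (a * t) * (a * 1))) => //.
by rewrite mulr1 mulrC.
Qed.

Lemma is_derive_pow F n (t df : R) : is_derive t (1 : R) F df ->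
  is_derive t (1 : R) (fun s => F s ^+ n.+1) (n.+1%:R * F t ^+ n * df).
Proof.
move=> dF; apply: (is_derive_ext (f := F ^+ n.+1)
  (df := (n.+1%:R * F t ^+ n) *: df)) => // s.
by elim: n.+1 => [|k ih] //; rewrite !exprS -ih.
Qed.

Lemma is_derive_exprn n (t : R) :
  is_derive t (1 : R) (fun s : R => s ^+ n.+1) (n.+1%:R * t ^+ n).
Proof.
by apply: (is_derive_ext _ _ (is_derive_pow n (is_derive_id t (1 : R)))); rewrite ?mulr1.
Qed.

Lemma is_derive_mul F G (t df dg : R) :
  is_derive t (1 : R) F df -> is_derive t (1 : R) G dg ->
  is_derive t (1 : R) (fun s => F s * G s) (df * G t + F t * dg).
Proof.
move=> hF hG; apply: (is_derive_ext (f := F * G) (df := F t *: dg + G t *: df)) => //.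
by rewrite /GRing.scale /= addrC mulrC.
Qed.

Lemma is_derive_add F G (t df dg : R) :
  is_derive t (1 : R) F df -> is_derive t (1 : R) G dg ->
  is_derive t (1 : R) (fun s => F s + G s) (df + dg).
Proof. by move=> hF hG; apply: is_deriveD. Qed.

Lemma expR_taylor_sign (a : R) n t : a ^+ 2 = 1 -> 0 <= t <= 1 ->
  0 <= a ^+ n * (expR (a * t) - \sum_(k < n) (a * t) ^+ k / k`!%:R).
Proof.
move=> a2; elim: n t => [|n ih] t t01.
  by rewrite big_ord0 expr0 mul1r subr0 expR_ge0.
pose P n (s : R) := \sum_(k < n) (a * s) ^+ k / k`!%:R.
have dP s : is_derive s (1 : R) (P n.+1) (a * P n s).
  apply: (is_derive_ext (f := fun s => 1 + \sum_(k < n) (a ^+ k.+1 / k.+1`!%:R) * s ^+ k.+1)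
     (df := 0 + \sum_(k < n) (a ^+ k.+1 / k.+1`!%:R) * (k.+1%:R * s ^+ k))).
  - move=> u; rewrite /P big_ord_recl expr0 divr1; congr +%R.
    by apply: eq_bigr => k _; rewrite lift0 exprMn; ring.
  - rewrite add0r mulr_sumr; apply: eq_bigr => k _.
    have k1 : k.+1%:R != 0 :> R by rewrite pnatr_eq0.
    have kf : k`!%:R != 0 :> R by rewrite pnatr_eq0 -lt0n fact_gt0.
    rewrite exprMn factS natrM exprS; move: k.+1%:R k`!%:R k1 kf => u v u0 v0.
    by field; rewrite u0 v0.
  - apply: is_derive_add.
    apply: is_derive_bigsum => k; apply: is_derive_scale.
    exact: is_derive_exprn.
pose H s := a ^+ n.+1 * (expR (a * s) + (-1) * P n.+1 s).
have dH s : is_derive s (1 : R) H (a ^+ n.+1 * (a * expR (a * s) + (-1) * (a * P n s))).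
  apply: is_derive_scale; apply: is_derive_add; first exact: is_derive_expM.
have : (fun _ : R => 0) t <= H t.
  apply: (le_of_le_deriv (f := fun=> 0) _ dH) => //.
    rewrite /H /P big_ord_recl big1 => [|k _]; last by rewrite mulr0 expr0n mul0r.
    by rewrite mulr0 expR0 expr0 fact0 divr1 addr0 mulN1r subrr mulr0.
  move=> s s01; have -> : a ^+ n.+1 * (a * expR (a * s) + -1 * (a * P n s)) =
     a ^+ 2 * (a ^+ n * (expR (a * s) - P n s)) by rewrite exprS; ring.
  by rewrite a2 mul1r ih.
by rewrite /H mulN1r.
Qed.

End Comparison.

Section NestedIntegrals.
Variable R : realType.
Implicit Types (t y z : R) (k : nat).

(* The integral over [0, y] of (1 - t) ^ k; geo2 and geo3 are the iterated
   integrals attached to the chains of length two and three. *)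
Definition geo k y : R := k.+1%:R^-1 * (1 - (1 - y) ^+ k.+1).
Definition geo2 k2 k3 y : R := k3.+1%:R^-1 * (geo k2 y - geo (k2 + k3).+1 y).
Definition geo3 k1 k2 k3 y : R := k3.+1%:R^-1 *
  (k2.+1%:R^-1 * (geo k1 y - geo (k1 + k2).+1 y) -
   (k2 + k3).+2%:R^-1 * (geo k1 y - geo (k1 + k2 + k3).+2 y)).

Lemma geo_at0 k : geo k 0 = 0.
Proof. by rewrite /geo subr0 expr1n subrr mulr0. Qed.

Lemma geo2_at0 k2 k3 : geo2 k2 k3 0 = 0.
Proof. by rewrite /geo2 !geo_at0 subrr mulr0. Qed.

Lemma geo3_at0 k1 k2 k3 : geo3 k1 k2 k3 0 = 0.
Proof. by rewrite /geo3 !geo_at0 !subrr !mulr0 subrr mulr0. Qed.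

Lemma geo_at1 k : geo k 1 = k.+1%:R^-1.
Proof. by rewrite /geo subrr expr0n subr0 mulr1. Qed.

Lemma geo3_at1 k1 k2 k3 : geo3 k1 k2 k3 1 =
  ((k1 + 1)%:R * (k1 + k2 + 2)%:R * (k1 + k2 + k3 + 3)%:R)^-1.
Proof.
rewrite /geo3 !geo_at1 !addn1 !addn2 !addn3.
rewrite -[k1.+1]addn1 -[k2.+1]addn1 -[k3.+1]addn1.
rewrite -[(k2 + k3).+2]addn2 -[(k1 + k2).+2]addn2 -[(k1 + k2 + k3).+3]addn3.
rewrite !natrD; have := ler0n R k1; have := ler0n R k2; have := ler0n R k3.
move: k1%:R k2%:R k3%:R => a b c c0 b0 a0; field.
by rewrite !gt_eqF //; lra.
Qed.

Lemma is_derive_geo k t : is_derive t (1 : R) (geo k) ((1 - t) ^+ k).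
Proof.
have k1 : k.+1%:R != 0 :> R by rewrite pnatr_eq0.
have d1 : is_derive t (1 : R) (fun s : R => 1 - s) (- 1).
  apply: (is_derive_ext (f := cst 1 - id) (df := 0 - 1)) => //.
  by rewrite sub0r.
apply: (is_derive_ext (f := fun s => k.+1%:R^-1 * (1 + (-1) * (1 - s) ^+ k.+1))
   (df := k.+1%:R^-1 * (0 + (-1) * (k.+1%:R * (1 - t) ^+ k * (- 1))))).
- by move=> s; rewrite /geo mulN1r.
- by move: k.+1%:R k1 => u u0; field.
apply: is_derive_scale; apply: is_derive_add; apply: is_derive_scale.
exact: is_derive_pow.
Qed.

Lemma is_derive_geo2 k2 k3 t :
  is_derive t (1 : R) (geo2 k2 k3) ((1 - t) ^+ k2 * geo k3 t).
Proof.
apply: (is_derive_ext (f := fun s => k3.+1%:R^-1 * (geo k2 s + (-1) * geo (k2 + k3).+1 s))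
   (df := k3.+1%:R^-1 * ((1 - t) ^+ k2 + (-1) * (1 - t) ^+ (k2 + k3).+1))).
- by move=> s; rewrite /geo2 mulN1r.
- by rewrite /geo -addnS exprD; ring.
apply: is_derive_scale; apply: is_derive_add; first exact: is_derive_geo.
apply: is_derive_scale; exact: is_derive_geo.
Qed.

Lemma is_derive_geo3 k1 k2 k3 t :
  is_derive t (1 : R) (geo3 k1 k2 k3) ((1 - t) ^+ k1 * geo2 k2 k3 t).
Proof.
pose h k l (s : R) := l%:R^-1 * (geo k1 s + (-1) * geo (k1 + k).+1 s).
have dh k l s : is_derive s (1 : R) (h k l)
    (l%:R^-1 * ((1 - s) ^+ k1 + (-1) * (1 - s) ^+ (k1 + k).+1)).
  apply: is_derive_scale; apply: is_derive_add; first exact: is_derive_geo.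
  apply: is_derive_scale; exact: is_derive_geo.
apply: (is_derive_ext (f := fun s => k3.+1%:R^-1 *
     (h k2 k2.+1 s + (-1) * h (k2 + k3).+1 (k2 + k3).+2 s)) (df := k3.+1%:R^-1 *
   ((k2.+1%:R^-1 * ((1 - t) ^+ k1 + (-1) * (1 - t) ^+ (k1 + k2).+1)) + (-1) *
    ((k2 + k3).+2%:R^-1 * ((1 - t) ^+ k1 + (-1) * (1 - t) ^+ (k1 + (k2 + k3).+1).+1))))).
- by move=> s; rewrite /geo3 /h addnS addnA; ring.
- by rewrite /geo2 /geo -!addnS !exprD; ring.
Qed.

Lemma expR_ge_taylor n t : 0 <= t <= 1 ->
  \sum_(k < n) t ^+ k / k`!%:R <= expR t.
Proof.
move=> t01; have := expR_taylor_sign n (expr1n R 2) t01.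
by rewrite expr1n !mul1r subr_ge0.
Qed.

Lemma expRN_le_taylor n t : odd n -> 0 <= t <= 1 ->
  expR (- t) <= \sum_(k < n) (- t) ^+ k / k`!%:R.
Proof.
move=> n_odd t01; have := expR_taylor_sign n (sqrr_sign R 1) t01.
by rewrite expr1 -signr_odd n_odd expr1 !mulN1r oppr_ge0 subr_le0.
Qed.

Lemma expRN_ge_taylor n t : ~~ odd n -> 0 <= t <= 1 ->
  \sum_(k < n) (- t) ^+ k / k`!%:R <= expR (- t).
Proof.
move=> n_even t01; have := expR_taylor_sign n (sqrr_sign R 1) t01.
by rewrite expr1 -signr_odd (negPf n_even) expr0 !mulN1r mul1r subr_ge0.
Qed.

(* Cubic minorant of (1 - exp(- m)) / m on [0, 1], nearly tight around m = 7/10. *)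
Definition decay_cubic (m : R) : R :=
  1 - m / 2 + 163 / 1000 * m ^+ 2 - 32 / 1000 * m ^+ 3.

Lemma decay_cubic_le t : 0 <= t <= 1 -> t * decay_cubic t <= 1 - expR (- t).
Proof.
move=> t01; have /andP[t0 t1] := t01.
have := @expRN_le_taylor 7 t isT t01; rewrite !big_ord_recr big_ord0 /= !factS fact0.
move=> h; suff : t * decay_cubic t <= 1 -
   (1 - t + t ^+ 2 / 2 - t ^+ 3 / 6 + t ^+ 4 / 24 - t ^+ 5 / 120 + t ^+ 6 / 720) by lra.
rewrite /decay_cubic -subr_ge0.
have -> : 1 - (1 - t + t ^+ 2 / 2 - t ^+ 3 / 6 + t ^+ 4 / 24 - t ^+ 5 / 120 +
  t ^+ 6 / 720) - t * (1 - t / 2 + 163 / 1000 * t ^+ 2 - 32 / 1000 * t ^+ 3) =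
  t ^+ 3 * ((11 / 3000 - 29 / 3000 * t + 1 / 120 * t ^+ 2 - 1 / 720 * t ^+ 3)) :> R.
  by field.
apply: mulr_ge0; first exact: exprn_ge0.
nra.
Qed.

Lemma decay_integral (eta : R) : 0 <= eta <= 1 ->
  exists psi : R -> R, [/\ psi 0 = 0,
    forall t, is_derive t (1 : R) psi (expR (- eta * t)) &
    forall t, 0 <= t <= 1 -> t * decay_cubic (eta * t) <= psi t].
Proof.
move=> /andP[e0 e1]; have [->|en] := eqVneq eta 0.
  exists id; split=> // t; first by rewrite oppr0 mul0r expR0; apply: is_derive_id.
  by rewrite /decay_cubic !mul0r subr0 !expr0n !mulr0 subr0 addr0 mulr1.
exists (fun t => - eta^-1 * (expR (- eta * t) + (-1))); split.
- by rewrite mulr0 expR0 subrr mulr0.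
- move=> t; apply: (is_derive_ext (f := fun t => - eta^-1 * (expR (- eta * t) + (-1)))
    (df := - eta^-1 * (- eta * expR (- eta * t) + 0))) => //.
  by field.
  apply: is_derive_scale; apply: is_derive_add; first exact: is_derive_expM.
move=> t /andP[t0 t1].
have ep : 0 < eta by rewrite lt_neqAle eq_sym en.
have m01 : 0 <= eta * t <= 1 by rewrite mulr_ge0 // mulr_ile1.
have := decay_cubic_le m01; rewrite -mulNr => h.
have -> : - eta^-1 * (expR (- eta * t) + -1) = (1 - expR (- eta * t)) / eta by field.
by rewrite ler_pdivlMr // mulrAC [t * eta]mulrC.
Qed.

End NestedIntegrals.

Section WeightedIntegral.
Variable R : realType.
Implicit Types (f g : R -> R) (u v : R).

(* v is the integral over [0, 1] of exp(- 2 t) f(t) dt. *)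
Definition has_wint f v := exists F : R -> R,
  (forall t, is_derive t (1 : R) F (expR (- 2 * t) * f t)) /\ F 1 - F 0 = v.

Lemma has_wint_ext f g u v : f =1 g -> u = v -> has_wint f u -> has_wint g v.
Proof. by move=> /funext -> ->. Qed.

Lemma has_wintD f g u v :
  has_wint f u -> has_wint g v -> has_wint (fun t => f t + g t) (u + v).
Proof.
move=> [F [dF <-]] [G [dG <-]]; exists (fun t => F t + G t); split=> [t|]; last by ring.
by rewrite mulrDr; apply: is_derive_add.
Qed.

Lemma has_wintZ f v (a : R) :
  has_wint f v -> has_wint (fun t => a * f t) (a * v).
Proof.
move=> [F [dF <-]]; exists (fun t => a * F t); split=> [t|]; last by ring.
by rewrite mulrCA; apply: is_derive_scale.
Qed.

Lemma has_wint_sum (I : finType) (P : pred I) (f : I -> R -> R) (v : I -> R) :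
    (forall i, P i -> has_wint (f i) (v i)) ->
  has_wint (fun t => \sum_(i | P i) f i t) (\sum_(i | P i) v i).
Proof.
move=> h; elim: (index_enum I) => [|i r ih].
  apply: (has_wint_ext (f := fun=> 0 * 0) (u := 0 * 0)) => [t||].
  - by rewrite big_nil mulr0.
  - by rewrite big_nil mulr0.
  exists (fun=> 0); split=> [t|]; last by rewrite mulr0 subrr.
  by rewrite !mulr0; apply: is_derive_cst.
case Pi: (P i); last by apply: has_wint_ext ih => [t|]; rewrite big_cons Pi.
apply: (has_wint_ext _ _ (has_wintD (h i Pi) ih)) => [t|]; by rewrite big_cons Pi.
Qed.

Fixpoint mom k : R :=
  if k is k'.+1 then (k'.+1%:R * mom k' - expR (- 2)) / 2 else (1 - expR (- 2)) / 2.

Lemma has_wint_monomial k : has_wint (fun t => t ^+ k) (mom k).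
Proof.
elim: k => [|k [F [dF F01]]].
  exists (fun t => - 2^-1 * expR (- 2 * t)); split=> [t|]; last first.
    by rewrite mulr1 mulr0 expR0 /=; field.
  apply: (is_derive_ext (f := fun t => - 2^-1 * expR (- 2 * t))
    (df := - 2^-1 * (- 2 * expR (- 2 * t)))) => //.
    by rewrite expr0; field.
  by apply: is_derive_scale; apply: is_derive_expM.
exists (fun t => 2^-1 * (k.+1%:R * F t + (-1) * (t ^+ k.+1 * expR (- 2 * t)))).
split=> [t|]; last first.
  rewrite /= -F01 mulr1 mulr0 expR0 expr1n expr0n /= mul0r; move: k.+1%:R => u.
  by field.
have d := is_derive_scale 2^-1 (is_derive_add (is_derive_scale k.+1%:R (dF t))
  (is_derive_scale (-1) (is_derive_mul (is_derive_exprn k t) (is_derive_expM (-2) t)))).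
apply: (is_derive_ext _ _ d) => //.
by move: k.+1%:R => u; field.
Qed.

Lemma has_wint_poly n (c : 'I_n -> R) :
  has_wint (fun t => \sum_(k < n) c k * t ^+ k) (\sum_(k < n) c k * mom k).
Proof. by apply: has_wint_sum => k _; apply: has_wintZ; apply: has_wint_monomial. Qed.

Lemma le_wint (a : R) f v (H h : R -> R) :
    has_wint f v -> (forall t, is_derive t (1 : R) H (h t)) ->
    (forall t, 0 <= t <= 1 -> a * (expR (- 2 * t) * f t) <= h t) ->
  a * v <= H 1 - H 0.
Proof.
move=> [F [dF <-]] dH fh.
pose H' t := H t + - H 0.
have dH' t : is_derive t (1 : R) H' (h t + 0).
  by apply: is_derive_add.
pose F' t := a * (F t + - F 0).
have dF' t : is_derive t (1 : R) F' (a * ((expR (- 2 * t) * f t) + 0)).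
  by apply: is_derive_scale; apply: is_derive_add.
suff : F' 1 <= H' 1 by [].
apply: (le_of_le_deriv dF' dH'); rewrite ?ler01 ?lexx //.
  by rewrite /F' /H' !subrr mulr0.
by move=> t t01; rewrite !addr0 fh.
Qed.

End WeightedIntegral.

(** * Numerical inequalities *)

Section Constants.
Variable R : realType.

Definition slope : R := 3 - expR 1.
Definition alp : R := (1 - slope) ^+ 2.

Lemma expRN1_bounds :
  367 / 10 ^+ 3 + 879 / 10 ^+ 6 + 43 / 10 ^+ 8 <= expR (- 1 : R) <=
  367 / 10 ^+ 3 + 879 / 10 ^+ 6 + 47 / 10 ^+ 8.
Proof.
have i01 : 0 <= (1 : R) <= 1 by rewrite ler01 lexx.
have lo := @expRN_ge_taylor R 12 1 isT i01; have hi := @expRN_le_taylor R 11 1 isT i01.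
rewrite !big_ord_recr big_ord0 /= in lo hi.
rewrite !factS fact0 in lo hi.
apply/andP; split; lra.
Qed.

Lemma expR1_bounds :
  2 + 718 / 10 ^+ 3 + 281 / 10 ^+ 6 <= expR (1 : R) <=
  2 + 718 / 10 ^+ 3 + 282 / 10 ^+ 6.
Proof.
have /andP[lo hi] := expRN1_bounds.
have e0 := expR_gt0 (1 : R).
have := expRxMexpNx_1 (1 : R) => h.
apply/andP; split; nra.
Qed.

Lemma expRN2_bounds :
  135 / 10 ^+ 3 + 335 / 10 ^+ 6 <= expR (- 2 : R) <= 135 / 10 ^+ 3 + 336 / 10 ^+ 6.
Proof.
have /andP[lo hi] := expRN1_bounds.
have -> : expR (- 2) = expR (- 1) ^+ 2 :> R.
  by rewrite expr2 -expRD; congr expR; lra.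
by apply/andP; split; nra.
Qed.

Lemma slope_bounds :
  281 / 10 ^+ 3 + 71 / 10 ^+ 5 <= slope <= 281 / 10 ^+ 3 + 72 / 10 ^+ 5.
Proof. by have /andP[lo hi] := expR1_bounds; rewrite /slope; apply/andP; split; lra. Qed.

Lemma alp_bounds : 515 / 10 ^+ 3 + 9 / 10 ^+ 4 <= alp <= 516 / 10 ^+ 3.
Proof. by have /andP[lo hi] := slope_bounds; rewrite /alp; apply/andP; split; nra. Qed.

Lemma slope2_bounds :
  79 / 10 ^+ 3 + 3 / 10 ^+ 4 <= slope ^+ 2 <= 79 / 10 ^+ 3 + 4 / 10 ^+ 4.
Proof. by have /andP[lo hi] := slope_bounds; apply/andP; split; nra. Qed.

Lemma delta_bounds p : 0 <= p <= 1 ->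
  (563 / 10 ^+ 3 + 4 / 10 ^+ 4) - (79 / 10 ^+ 3 + 4 / 10 ^+ 4) * p <=
  2 * slope - slope ^+ 2 * p <=
  (563 / 10 ^+ 3 + 5 / 10 ^+ 4) - (79 / 10 ^+ 3 + 3 / 10 ^+ 4) * p.
Proof.
move=> /andP[p0 p1]; have /andP[lo hi] := slope_bounds.
have /andP[/(ler_wpM2r p0) lo2 /(ler_wpM2r p0) hi2] := slope2_bounds.
by apply/andP; split; lra.
Qed.

Lemma gammaE : gamma R = mom R 0 + alp * mom R 2.
Proof.
rewrite /gamma /alp /slope /=.
have -> : expR (- 2) = (expR 1 ^+ 2)^-1 :> R.
  by rewrite expr2 -expRD -expRN; congr expR; lra.
have e0 := expR_gt0 (1 : R); move: (expR 1) e0 => e e0.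
by field; rewrite gt_eqF.
Qed.

Lemma gamma_ge : 474 / 10 ^+ 3 + 35 / 10 ^+ 6 <= gamma R.
Proof.
have /andP[lo hi] := expR1_bounds.
rewrite /gamma; move: (expR 1) lo hi => e lo hi.
rewrite ler_pdivlMr; last by nra.
pose t := e - (2 + 718 / 10 ^+ 3 + 281 / 10 ^+ 6).
have t0 : 0 <= t by rewrite subr_ge0.
have t1 : t <= 1 / 10 ^+ 6 by rewrite /t; lra.
have -> : e = (2 + 718 / 10 ^+ 3 + 281 / 10 ^+ 6) + t by rewrite /t; lra.
clearbody t; clear e lo hi.
nra.
Qed.

End Constants.

Section BoxPositivity.
Variable R : realType.

Definition affine (g : R -> R) := forall s, g s = g 0 + s * (g 1 - g 0).

Lemma affine_ge0 (g : R -> R) lo hi t : affine g -> lo <= t <= hi ->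
  0 <= g lo -> 0 <= g hi -> 0 <= g t.
Proof.
move=> ga /andP[lt th]; rewrite (ga lo) (ga hi) (ga t).
move: (g 0) (g 1 - g 0) => u v; have [v0|v0] := lerP 0 v; nra.
Qed.

(* delta stands for (1 - a1 p) / p = 2 c - c ^ 2 p. *)
Lemma box_ge0 (G : R -> R -> R -> R) (p d : R) :
    0 <= p <= 1 -> d = 2 * slope R - slope R ^+ 2 * p ->
    (forall a E, affine (fun d => G d a E)) ->
    (forall d E, affine (fun a => G d a E)) -> (forall d a, affine (G d a)) ->
    let dlo := (563 / 10 ^+ 3 + 4 / 10 ^+ 4) - (79 / 10 ^+ 3 + 4 / 10 ^+ 4) * p in
    let dhi := (563 / 10 ^+ 3 + 5 / 10 ^+ 4) - (79 / 10 ^+ 3 + 3 / 10 ^+ 4) * p in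
    let alo := 515 / 10 ^+ 3 + 9 / 10 ^+ 4 in let ahi := 516 / 10 ^+ 3 in
    let Elo := 135 / 10 ^+ 3 + 335 / 10 ^+ 6 in let Ehi := 135 / 10 ^+ 3 + 336 / 10 ^+ 6 in
    0 <= G dlo alo Elo -> 0 <= G dlo alo Ehi -> 0 <= G dlo ahi Elo -> 0 <= G dlo ahi Ehi ->
    0 <= G dhi alo Elo -> 0 <= G dhi alo Ehi -> 0 <= G dhi ahi Elo -> 0 <= G dhi ahi Ehi ->
  0 <= G d (alp R) (expR (- 2)).
Proof.
move=> p01 -> Gd Ga GE dlo dhi alo ahi Elo Ehi g1 g2 g3 g4 g5 g6 g7 g8.
by apply: (affine_ge0 (Gd _ _) (delta_bounds p01));
  apply: (affine_ge0 (Ga _ _) (alp_bounds R));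
  apply: (affine_ge0 (GE _ _) (expRN2_bounds R)).
Qed.

(* With E = exp(- 2), M1, ..., M7 are the moments mom 1, ..., mom 7. *)
Definition M1 (E : R) := (1 - 3 * E) / 4.
Definition M2 (E : R) := (1 - 5 * E) / 4.
Definition M3 (E : R) := (3 - 19 * E) / 8.
Definition M4 (E : R) := (3 - 21 * E) / 4.

Local Notation delta p := (2 * slope R - slope R ^+ 2 * p).

(* The proof of pair_ineq produces the terms p ^ 2 (sq_coef0 + x sq_coef1) and
   p q (cross_coef0 + x cross_coef1), that of final_ineq the term x final_coef.
   Each of them is affine in delta, alp and exp(- 2) separately, so it is enough to
   check corners. *)
Definition sq_coef0 p d a E : R := d * M1 E + (p * d - 1 / 2) * M2 E
  - (1 - p * d) * p * M3 E / 2
  + a / 2 * ((1 - p) * (1 - p * d) * M3 E - (d + 1 - p * d + 103 / 100) * M2 E).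

Definition sq_coef1 p d a E : R := 2 * (d * M2 E + (p * d - 1 / 2) * M3 E
  - (1 - p * d) * p * M4 E / 2)
  + a / 2 * ((1 - p) * (1 - p * d) * M4 E - (d + 1 - p * d + 103 / 100) * M3 E).

Definition cross_coef0 p d (a E : R) : R :=
  103 / 100 * M2 E - (1 - p * d) * (M2 E + p * M3 E).

Definition cross_coef1 p d (a E : R) : R :=
  103 / 100 * M3 E - (1 - p * d) * (M3 E + p * M4 E).

Definition final_coef x d a E : R := (1 - x * d) * (2 * M1 E + 2 * x * M2 E
  + 4 / 3 * x ^+ 2 * M3 E + a * (M3 E - M2 E - x * M3 E)) - d * ((1 - E) / 2 + a * M2 E).

Local Ltac box p p01 :=
  apply: (box_ge0 p01 (erefl _));
  try (by move=> ? ? ?; rewrite /sq_coef0 /sq_coef1 /cross_coef0 /cross_coef1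
    /final_coef /M1 /M2 /M3 /M4; field);
  have := sqr_ge0 (p - 1 / 4); case/andP: p01 => ? ? ?;
  rewrite /sq_coef0 /sq_coef1 /cross_coef0 /cross_coef1 /final_coef
    /M1 /M2 /M3 /M4; nra.

Lemma sq_coef0_ge0 p : 0 <= p <= 1 -> 0 <= sq_coef0 p (delta p) (alp R) (expR (- 2)).
Proof. by move=> p01; box p p01. Qed.

Lemma sq_coef1_ge0 p : 0 <= p <= 1 -> 0 <= sq_coef1 p (delta p) (alp R) (expR (- 2)).
Proof. by move=> p01; box p p01. Qed.

Lemma cross_coef0_ge0 p : 0 <= p <= 1 -> 0 <= cross_coef0 p (delta p) (alp R) (expR (- 2)).
Proof. by move=> p01; box p p01. Qed.

Lemma cross_coef1_ge0 p : 0 <= p <= 1 -> 0 <= cross_coef1 p (delta p) (alp R) (expR (- 2)).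
Proof. by move=> p01; box p p01. Qed.

Lemma final_coef_ge0 p : 0 <= p <= 1 -> 0 <= final_coef p (delta p) (alp R) (expR (- 2)).
Proof. by move=> p01; box p p01. Qed.

Definition M5 (E : R) := (15 - 109 * E) / 8.
Definition M6 (E : R) := (45 - 331 * E) / 8.
Definition M7 (E : R) := (315 - (2 * 1000 + 325) * E) / 16.

Definition Bmom (c m2 m3 m4 m5 : R) : R :=
  c * m2 - m3 / 2 + 163 / 1000 * m4 - 32 / 1000 * m5.

Lemma Bmom_ge0 (x p : R) (c := slope R) (E := expR (- 2)) :
    0 <= x -> 0 <= p -> x + p <= 1 ->
  0 <= Bmom c (M2 E) (M3 E) (M4 E) (M5 E) + (x + p) * Bmom c (M3 E) (M4 E) (M5 E) (M6 E)
    + x * p * Bmom c (M4 E) (M5 E) (M6 E) (M7 E).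
Proof.
move=> x0 p0 xp; pose b := Bmom c.
have /andP[clo chi] := slope_bounds R; have /andP[Elo Ehi] := expRN2_bounds R.
rewrite -/c -/E in clo chi Elo Ehi.
have h1 : b (M3 E) (M4 E) (M5 E) (M6 E) <= 0.
  rewrite /b /Bmom /M3 /M4 /M5 /M6; clearbody c E; clear -clo chi Elo Ehi; nra.
have h2 : b (M4 E) (M5 E) (M6 E) (M7 E) <= 0.
  rewrite /b /Bmom /M4 /M5 /M6 /M7; clearbody c E; clear -clo chi Elo Ehi; nra.
have h0 : 0 <= b (M2 E) (M3 E) (M4 E) (M5 E) + b (M3 E) (M4 E) (M5 E) (M6 E)
   + b (M4 E) (M5 E) (M6 E) (M7 E) / 4.
  rewrite /b /Bmom /M2 /M3 /M4 /M5 /M6 /M7; clearbody c E; clear -clo chi Elo Ehi; nra.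
rewrite -/b; move: (b (M2 E) _ _ _) (b (M3 E) _ _ _) (b (M4 E) _ _ _) h0 h1 h2.
move=> b0 b1 b2 h0 h1 h2.
have w : x * p <= 1 / 4 by have := sqr_ge0 (x - p); nra.
have := ler_wnM2r h1 xp; have := ler_wnM2r h2 w; lra.
Qed.

End BoxPositivity.

Section PointwiseBounds.
Variable R : realType.
Local Notation c := (slope R).
Local Notation E2 := (expR (- 2) : R).

(* Since 1 + t + t ^ 2 / 2 <= exp t, this is at most (1 - y r) exp (y p) - 1. *)
Definition gain (p y : R) : R :=
  (1 - y * (p * a1 p)) * (1 + y * p + (y * p) ^+ 2 / 2) - 1.
Definition Aq (y : R) : R := alp R / 2 * y ^+ 2.
Definition Bq (y : R) : R := (1 - c) * y ^+ 2 *
  (c - (y / 2 - 163 / 1000 * y ^+ 2 + 32 / 1000 * y ^+ 3)).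

Lemma a1E (p : R) : a1 p = 1 - p * (2 * c - c ^+ 2 * p).
Proof. by rewrite /a1 -/(slope R); ring. Qed.

Lemma a1_itv (p : R) : 0 <= p <= 1 -> 0 <= a1 p <= 1.
Proof.
move=> p01; have /andP[d1 d2] := delta_bounds p01; case/andP: p01 => p0 p1.
by rewrite {1}/a1 sqr_ge0 a1E gerBl mulr_ge0 //; lra.
Qed.

Lemma gain_ge0 (p y : R) : 0 <= p <= 1 -> 0 <= y <= 1 -> 0 <= gain p y.
Proof.
move=> p01 /andP[y0 y1]; rewrite /gain a1E.
have /andP[] := delta_bounds p01; case/andP: p01 => p0 p1.
move: (2 * c - c ^+ 2 * p) => d d1 d2.
have -> : (1 - y * (p * (1 - p * d))) * (1 + y * p + (y * p) ^+ 2 / 2) - 1 =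
  y * p ^+ 2 * (d + y * (p * d - 1 / 2 - p * (1 - p * d) / 2)
     + y * (1 - y) * (p * (1 - p * d)) / 2) by field.
have d0 : 0 <= d by lra.
have pd1 : 0 <= 1 - p * d by nra.
apply: mulr_ge0; first by rewrite mulr_ge0 ?sqr_ge0.
apply: addr_ge0; last by rewrite divr_ge0 // !mulr_ge0 // subr_ge0.
suff : 0 <= d + (p * d - 1 / 2 - p * (1 - p * d) / 2).
  move: (p * d - 1 / 2 - p * (1 - p * d) / 2) => u; nra.
have -> : d + (p * d - 1 / 2 - p * (1 - p * d) / 2) =
   d * (1 + p + p ^+ 2 / 2) - (1 + p) / 2 by field.
have : 0 <= (d - (563 / 10 ^+ 3 + 4 / 10 ^+ 4 - (79 / 10 ^+ 3 + 4 / 10 ^+ 4) * p)) *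
    (1 + p + p ^+ 2 / 2) by apply: mulr_ge0; [lra | nra].
clear -p0 p1; nra.
Qed.

Lemma expR_gain_le (p y : R) : 0 <= p <= 1 -> 0 <= y <= 1 ->
  expR (- (y * p)) * (1 + gain p y) <= 1 - y * (p * a1 p).
Proof.
move=> p01 y01; have /andP[a0 a1'] := a1_itv p01.
have /andP[p0 p1] := p01; have /andP[y0 y1] := y01.
have yp : 0 <= y * p <= 1 by rewrite mulr_ge0 // mulr_ile1.
have := @expR_ge_taylor R 3 _ yp; rewrite !big_ord_recr big_ord0 /= !factS fact0 => h.
have hT : 1 + y * p + (y * p) ^+ 2 / 2 <= expR (y * p).
  by apply: le_trans h; lra.
have r0 : 0 <= 1 - y * (p * a1 p).
  have r1 : p * a1 p <= 1 by rewrite mulr_ile1.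
  by rewrite subr_ge0 mulr_ile1 // mulr_ge0.
have -> : 1 + gain p y = (1 - y * (p * a1 p)) * (1 + y * p + (y * p) ^+ 2 / 2).
  by rewrite /gain; ring.
have := ler_wpM2l r0 hT => /(ler_wpM2l (expR_ge0 (- (y * p)))) /le_trans; apply.
by rewrite mulrCA [expR (- _) * _]mulrC expRxMexpNx_1 mulr1.
Qed.

Lemma Bfactor_ge (y : R) : 0 <= y <= 1 ->
  - 23 / 100 <= c - (y / 2 - 163 / 1000 * y ^+ 2 + 32 / 1000 * y ^+ 3).
Proof.
move=> /andP[y0 y1]; have /andP[c1 c2] := slope_bounds R.
have : 0 <= y ^+ 2 * (163 / 1000 - 32 / 1000 * y) by rewrite mulr_ge0 ?sqr_ge0 //; lra.
by lra.
Qed.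

Lemma AB_ge0 (q y : R) : 0 <= q <= 1 -> 0 <= y <= 1 -> 0 <= Aq y + (1 - q) * Bq y.
Proof.
move=> /andP[q0 q1] y01; have := Bfactor_ge y01.
have /andP[c1 c2] := slope_bounds R.
rewrite /Aq /Bq /alp; move: (c - _) => s s1.
have -> : (1 - c) ^+ 2 / 2 * y ^+ 2 + (1 - q) * ((1 - c) * y ^+ 2 * s) =
   (1 - c) * y ^+ 2 * ((1 - c) / 2 + (1 - q) * s) by field.
have c0 : 0 <= 1 - c by lra.
by apply: mulr_ge0; [rewrite mulr_ge0 ?sqr_ge0 | nra].
Qed.

Lemma AB_le (q y psi : R) : 0 <= q <= 1 -> 0 <= y <= 1 ->
    y * decay_cubic ((1 - q) * y) <= psi ->
  Aq y + (1 - q) * Bq y <= a1 q * (psi ^+ 2 / 2).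
Proof.
move=> /andP[q0 q1] y01 hpsi; have sB := Bfactor_ge y01.
have /andP[c1 c2] := slope_bounds R; have /andP[y0 y1] := y01.
pose eta := 1 - q; have e0 : 0 <= eta by rewrite subr_ge0.
have e1 : eta <= 1 by rewrite /eta; lra.
set s := c - _ in sB.
pose w := (1 - c) + eta * s.
pose u := (1 - c * q) * decay_cubic (eta * y).
have w0 : 0 <= w by rewrite /w; clearbody s eta; nra.
have wu : w <= u.
  have -> : u = w + eta * (1 - eta) * y * (c / 2 - 163 / 1000 * y * (1 + c * eta)
     + 32 / 1000 * y ^+ 2 * (1 + eta + c * eta ^+ 2)).
    by rewrite /u /w /s /decay_cubic (_ : q = 1 - eta); [field | rewrite /eta; ring].
  rewrite lerDl; apply: mulr_ge0; first by rewrite !mulr_ge0 // subr_ge0.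
  have -> : c / 2 - 163 / 1000 * y * (1 + c * eta)
     + 32 / 1000 * y ^+ 2 * (1 + eta + c * eta ^+ 2) =
    (c / 2 - 163 / 1000 * (1 + c * eta) + 32 / 1000 * (1 + eta + c * eta ^+ 2)) +
    (1 - y) * (163 / 1000 * (1 + c * eta)
        - 32 / 1000 * (1 + y) * (1 + eta + c * eta ^+ 2)) by field.
  apply: addr_ge0.
    have : 0 <= (c - (281 / 10 ^+ 3 + 71 / 10 ^+ 5)) *
        (1 / 2 - 163 / 1000 * eta + 32 / 1000 * eta ^+ 2).
      apply: mulr_ge0; first by rewrite subr_ge0.
      by have := sqr_ge0 eta; lra.
    by have := sqr_ge0 (eta - 3 / 4); clear -e0 e1; nra.
  apply: mulr_ge0; first by rewrite subr_ge0.
  have c0 : 0 <= c by lra.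
  have h : 0 <= 1 + eta + c * eta ^+ 2.
    by have := mulr_ge0 c0 (sqr_ge0 eta); lra.
  have : 0 <= (1 - y) * (1 + eta + c * eta ^+ 2) by rewrite mulr_ge0 ?subr_ge0.
  have ce : 0 <= c * eta by rewrite mulr_ge0.
  have : 0 <= c * eta * (1 - eta) by rewrite mulr_ge0 // subr_ge0.
  by clear -e0 e1 ce; lra.
have cq : 0 <= 1 - c * q by nra.
have yu : y * u <= (1 - c * q) * psi.
  by rewrite /u mulrCA ler_wpM2l.
have h2 : (y * w) ^+ 2 <= ((1 - c * q) * psi) ^+ 2.
  have yw0 : 0 <= y * w by rewrite mulr_ge0.
  rewrite ler_sqr ?nnegrE //; first exact: le_trans (ler_wpM2l y0 wu) yu.
  exact: le_trans (le_trans yw0 (ler_wpM2l y0 wu)) yu.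
have -> : a1 q * (psi ^+ 2 / 2) = ((1 - c * q) * psi) ^+ 2 / 2.
  by rewrite /a1 -/(slope R); field.
have -> : Aq y + (1 - q) * Bq y = (y * w) ^+ 2 / 2 - (y * (eta * s)) ^+ 2 / 2.
  by rewrite /Aq /Bq /alp /w -/s /eta; field.
have := sqr_ge0 (y * (eta * s)); lra.
Qed.

End PointwiseBounds.

Section PairInequality.
Variable R : realType.
Local Notation c := (slope R).
Local Notation E2 := (expR (- 2) : R).
Local Notation m k := (mom R k).

Lemma has_wint_seq (s : seq R) :
  has_wint (fun t => \sum_(k < size s) s`_k * t ^+ k) (\sum_(k < size s) s`_k * m k).
Proof. exact: has_wint_poly (fun k : 'I_(size s) => s`_k). Qed.

Definition wgain (x p : R) : R := let r := p * a1 p in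
  (p - r) * (m 1 + 2 * x * m 2) + (p ^+ 2 / 2 - r * p) * (m 2 + 2 * x * m 3)
  - r * p ^+ 2 / 2 * (m 3 + 2 * x * m 4).

Lemma has_wint_gain (x p : R) :
  has_wint (fun y => (1 + 2 * x * y) * gain p y) (wgain x p).
Proof.
rewrite /wgain /gain; move: (a1 p) => a.
pose r := p * a.
apply: (has_wint_ext _ _ (has_wint_seq [:: 0; p - r; p ^+ 2 / 2 - r * p + 2 * x * (p - r);
  - (r * p ^+ 2 / 2) + 2 * x * (p ^+ 2 / 2 - r * p); - 2 * x * (r * p ^+ 2 / 2)])) => [y|];
  by rewrite !big_ord_recr big_ord0 /= /r; field.
Qed.

Definition wA (x p : R) : R := alp R / 2 * (m 2 + (x + p) * m 3 + x * p * m 4).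

Lemma has_wint_A (x p : R) :
  has_wint (fun y => (1 + x * y) * (1 + p * y) * Aq y) (wA x p).
Proof.
apply: (has_wint_ext _ _ (has_wintZ (alp R / 2)
   (has_wint_seq [:: 0; 0; 1; x + p; x * p]))) => [y|];
  by rewrite !big_ord_recr big_ord0 /Aq /wA /=; field.
Qed.

Definition wB (x p : R) : R := (1 - c) *
  (Bmom c (M2 E2) (M3 E2) (M4 E2) (M5 E2) +
   (x + p) * Bmom c (M3 E2) (M4 E2) (M5 E2) (M6 E2) +
   x * p * Bmom c (M4 E2) (M5 E2) (M6 E2) (M7 E2)).

Lemma has_wint_B (x p : R) :
  has_wint (fun y => (1 + x * y) * (1 + p * y) * Bq y) (wB x p).
Proof.
apply: (has_wint_ext _ _ (has_wintZ (1 - c) (has_wint_seq [:: 0; 0; c;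
  - (1 / 2) + (x + p) * c;
  163 / 1000 - (x + p) / 2 + x * p * c;
  - (32 / 1000) + (x + p) * (163 / 1000) - x * p / 2;
  - (x + p) * (32 / 1000) + x * p * (163 / 1000); - x * p * (32 / 1000)]))) => [y|];
  rewrite !big_ord_recr big_ord0.
  by rewrite /Bq /=; field.
by rewrite /wB /Bmom /M2 /M3 /M4 /M5 /M6 /M7 /=; field.
Qed.

Lemma wB_ge0 (x p : R) : 0 <= x -> 0 <= p -> x + p <= 1 -> 0 <= wB x p.
Proof.
move=> x0 p0 xp; have /andP[c1 c2] := slope_bounds R.
by apply: mulr_ge0; [lra | exact: Bmom_ge0].
Qed.

Definition expcubic (x y : R) : R :=
  1 + 2 * x * y + 2 * x ^+ 2 * y ^+ 2 + 4 / 3 * x ^+ 3 * y ^+ 3.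

Definition wexp (x : R) : R :=
  m 0 + 2 * x * m 1 + 2 * x ^+ 2 * m 2 + 4 / 3 * x ^+ 3 * m 3.

Lemma has_wint_expcubic (x : R) : has_wint (expcubic x) (wexp x).
Proof.
apply: (has_wint_ext _ _ (has_wint_seq [:: 1; 2 * x; 2 * x ^+ 2; 4 / 3 * x ^+ 3])) => [y|];
  by rewrite !big_ord_recr big_ord0 /expcubic /wexp /=; field.
Qed.

Lemma wA0_ge0 (x : R) : 0 <= x -> 0 <= wA x 0.
Proof.
move=> x0; have /andP[al0 _] := alp_bounds R; have /andP[E0 E1] := expRN2_bounds R.
rewrite /wA mulr0 mul0r !addr0; apply: mulr_ge0; first lra.
by apply: addr_ge0; [|apply: mulr_ge0 => //]; rewrite /=; lra.
Qed.

Lemma pair_ineq (x p q : R) : 0 <= x -> 0 <= p <= 1 -> 0 <= q ->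
  p * wA x 0 + 103 / 100 * wA x 0 / 2 * (p ^+ 2 - q ^+ 2) <=
  wgain x p + p * a1 p * (1 - p - q) * wA x p.
Proof.
move=> x0 p01 q0; have /andP[p0 p1] := p01.
have h0 := sq_coef0_ge0 p01; have h1 := sq_coef1_ge0 p01.
have k0 := cross_coef0_ge0 p01; have k1 := cross_coef1_ge0 p01.
have /andP[al0 _] := alp_bounds R.
have /andP[E0 E1] := expRN2_bounds R.
rewrite -subr_ge0.
have -> : wgain x p + p * a1 p * (1 - p - q) * wA x p -
   (p * wA x 0 + 103 / 100 * wA x 0 / 2 * (p ^+ 2 - q ^+ 2)) =
  p ^+ 2 * (sq_coef0 p (2 * c - c ^+ 2 * p) (alp R) E2 +
     x * sq_coef1 p (2 * c - c ^+ 2 * p) (alp R) E2) +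
  103 / 100 * (p - q) ^+ 2 / 2 * (alp R / 2 * (M2 E2 + x * M3 E2)) +
  p * q * (alp R / 2) * (cross_coef0 p (2 * c - c ^+ 2 * p) (alp R) E2 +
     x * cross_coef1 p (2 * c - c ^+ 2 * p) (alp R) E2).
  rewrite /wgain /wA a1E /sq_coef0 /sq_coef1 /cross_coef0 /cross_coef1 /M1 /M2 /M3 /M4 /=.
  move: (2 * c - c ^+ 2 * p) => d; clear; by field.
have m2 : 0 <= M2 E2 by rewrite /M2; lra.
have m3 : 0 <= M3 E2 by rewrite /M3; lra.
have a0 : 0 <= alp R / 2 by lra.
rewrite !addr_ge0 //.
- by rewrite mulr_ge0 ?sqr_ge0 // addr_ge0 // mulr_ge0.
- have sq := sqr_ge0 (p - q).
  by apply: mulr_ge0; [lra | rewrite mulr_ge0 // addr_ge0 // mulr_ge0].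
- by apply: mulr_ge0; [rewrite mulr_ge0 // mulr_ge0 | rewrite addr_ge0 // mulr_ge0].
Qed.

Lemma final_ineq (x : R) : 0 <= x <= 1 ->
  gamma R <= a1 x * (wexp x + 2 * (1 - x) * wA x 0).
Proof.
move=> x01; have := final_coef_ge0 x01; have /andP[x0 x1] := x01.
move=> /(mulr_ge0 x0) h; rewrite -subr_ge0; apply: le_trans h _.
rewrite gammaE a1E le_eqVlt; apply/orP; left; apply/eqP.
rewrite /wexp /wA /final_coef /M1 /M2 /M3 /=.
move: (2 * c - c ^+ 2 * x) => d; clear; by field.
Qed.

End PairInequality.

(** * The selection probability *)

Section ExpectationCalculus.
Variables (R : realType) (V : finType) (E : {set {set V}}).

Lemma is_derive_bexp (p : {set V} -> R) (F : {set {set V}} -> R -> R)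
    (dF : {set {set V}} -> R) (t : R) :
    (forall S, is_derive t (1 : R) (F S) (dF S)) ->
  is_derive t (1 : R) (fun s => bexp E p (fun S => F S s)) (bexp E p dF).
Proof.
move=> h; apply: is_derive_bigsum => S.
exact: is_derive_scale.
Qed.

Lemma prod_add1_ge (I : finType) (P : pred I) (d : I -> R) :
  (forall i, P i -> 0 <= d i) -> 1 + \sum_(i | P i) d i <= \prod_(i | P i) (1 + d i).
Proof.
move=> d0.
suff : 0 <= \sum_(i | P i) d i /\ 1 + \sum_(i | P i) d i <= \prod_(i | P i) (1 + d i).
  by case.
apply: (big_rec2 (fun s q => 0 <= s /\ 1 + s <= q)) => [|i q s Pi [s0 sq]].
  by rewrite addr0.
have di := d0 i Pi; split; first exact: addr_ge0.
have := ler_wpM2l (addr_ge0 ler01 di) sq; apply: le_trans.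
have := mulr_ge0 di s0; lra.
Qed.

Lemma prod_expR (I : finType) (P : pred I) (u : I -> R) (y : R) :
  \prod_(i | P i) expR (- (y * u i)) = expR (- (y * \sum_(i | P i) u i)).
Proof.
rewrite mulr_sumr -sumrN.
by elim/big_rec2: _ => [|i a b _ ->]; rewrite ?expR0 ?expRD.
Qed.

End ExpectationCalculus.

Section SelectionBound.
Variables (R : realType) (V : finType) (E : {set {set V}}) (x : {set V} -> R).
Hypotheses (hE : simple_graph E) (hx : one_regular E x).
Variables (e : {set V}) (eE : e \in E).

Local Notation nbr := (nbr E).
Local Notation blockers := (blockers E).
Local Notation r f := (x f * a1 (x f)).

Let xI f : f \in E -> 0 <= x f <= 1. Proof. exact: x_itv hx f. Qed.
Let aI f : f \in E -> 0 <= a1 (x f) <= 1. Proof. by move=> /xI; exact: a1_itv. Qed.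

Let r_ge0 f : f \in E -> 0 <= r f.
Proof.
move=> fE; case/andP: (xI fE) => ? _; case/andP: (aI fE) => ? _.
by rewrite mulr_ge0.
Qed.

Let nbrE f : f \in nbr e -> f \in E. Proof. by rewrite inE => /andP[]. Qed.

Lemma expR_le_survive g (y : R) : g \in E -> 0 <= y <= 1 ->
  expR (- (y * x g)) <= 1 - y * r g.
Proof.
move=> gE y01; have g0 := gain_ge0 (xI gE) y01.
apply: le_trans (expR_gain_le (xI gE) y01).
by rewrite ler_peMr ?expR_ge0 // lerDl.
Qed.

Lemma survive_ge0 g (y : R) : g \in E -> 0 <= y <= 1 -> 0 <= 1 - y * r g.
Proof. by move=> gE y01; apply: le_trans (expR_ge0 _) (expR_le_survive gE y01). Qed.

Lemma prod_survive_ge (S : {set {set V}}) (y b : R) : S \subset E -> 0 <= y <= 1 ->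
    \sum_(g in S) x g <= b ->
  expR (- (y * b)) <= \prod_(g in S) (1 - y * r g).
Proof.
move=> /subsetP SE /andP[y0 y1] Sb.
apply: (@le_trans _ _ (\prod_(g in S) expR (- (y * x g)))).
  by rewrite prod_expR ler_expR lerN2 ler_wpM2l.
apply: ler_prod => g gS; rewrite expR_ge0 expR_le_survive ?SE //.
by rewrite y0.
Qed.

Section Blocking.
Variables (f h : {set V}) (fN : f \in nbr e) (hB : h \in blockers e f).

Local Notation D := [set e; f; h].
Local Notation k1 Q := #|rivals1 E e f :&: Q|.
Local Notation k2 Q := #|rivals2 E e f h :&: Q|.
Local Notation k3 Q := #|rivals3 E e f h :&: Q|.
Local Notation eta := (1 - x h).
Local Notation coef y :=
  (r e * r f * r h * \prod_(g in rivals1 E e f) (1 - y * r g)).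
Let hE' : h \in E. Proof. exact: (subsetP (blockers_sub E e f)) hB. Qed.

Lemma bexp_point (y z s : R) : 0 <= y <= 1 -> 0 <= z <= 1 -> 0 <= s <= 1 ->
  coef y * (expR (- eta * z) * expR (- eta * s)) <=
  bexp E (fun g => r g) (fun Q => (D \subset Q)%:R *
    ((1 - y) ^+ k1 Q * ((1 - z) ^+ k2 Q * (1 - s) ^+ k3 Q))).
Proof.
move=> y01 z01 s01.
have [dD1 dD2 dD3 [d12 d13 d23]] := blocks_disjoint eE fN hB.
have [[fE _ fe he hf] _] := blockersP fN hB.
have DE : D \subset E by rewrite !subUset !sub1set eE fE hE'.
rewrite (bexp_blocks _ _ _ _ DE (rivals1_sub E e f) (rivals2_sub E e f h)
  (rivals3_sub E e f h) dD1 dD2 dD3 d12 d13 d23).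
have -> : \prod_(g in D) r g = r e * r f * r h.
  rewrite setUC big_setU1 ?inE ?negb_or ?he ?hf //=.
  rewrite big_setU1 ?inE 1?eq_sym //= big_set1; ring.
rewrite -[leLHS]mulrA; apply: ler_wpM2l.
  exact: mulr_ge0 (mulr_ge0 (r_ge0 eE) (r_ge0 fE)) (r_ge0 hE').
have simp (t : R) g : 1 - (1 - (1 - t)) * r g = 1 - t * r g by ring.
under [X in _ <= X * _]eq_bigr => g _ do rewrite simp.
under [X in _ <= _ * (X * _)]eq_bigr => g _ do rewrite simp.
under [X in _ <= _ * (_ * X)]eq_bigr => g _ do rewrite simp.
apply: ler_wpM2l.
  apply: prodr_ge0 => g gA; apply: survive_ge0 => //.
  exact: (subsetP (rivals1_sub E e f)).
have swap t : - eta * t = - (t * eta) by ring.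
rewrite !swap; apply: ler_pM; rewrite ?expR_ge0 //.
  exact: prod_survive_ge (rivals2_sub E e f h) z01 (sum_rivals2 hE hx eE fN hB).
exact: prod_survive_ge (rivals3_sub E e f h) s01 (sum_rivals3 hE hx eE fN hB).
Qed.

Lemma bexp_blocking (y : R) : 0 <= y <= 1 ->
  exists2 psi : R, y * decay_cubic (eta * y) <= psi &
  coef y * (psi ^+ 2 / 2) <=
  bexp E (fun g => r g) (fun Q => (D \subset Q)%:R *
    ((1 - y) ^+ k1 Q * geo2 (k2 Q) (k3 Q) y)).
Proof.
move=> y01.
have eta01 : 0 <= eta <= 1 by have /andP[? ?] := xI hE'; apply/andP; split; lra.
have [psi [psi0 dpsi psi_ge]] := decay_integral eta01.
exists (psi y); first exact: psi_ge.
have i0 : 0 <= (0 : R) <= 1 by rewrite lexx ler01.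
have step2 z s : 0 <= z <= 1 -> 0 <= s <= 1 ->
    coef y * expR (- eta * z) * psi s <=
    bexp E (fun g => r g) (fun Q => (D \subset Q)%:R *
      ((1 - y) ^+ k1 Q * (1 - z) ^+ k2 Q) * geo (k3 Q) s).
  move=> z01; move: s.
  apply: (le_of_le_deriv (f := fun s => coef y * expR (- eta * z) * expR (- eta * s))
    (g := fun s => bexp E (fun g => r g) (fun Q => (D \subset Q)%:R *
      ((1 - y) ^+ k1 Q * (1 - z) ^+ k2 Q) * (1 - s) ^+ k3 Q))).
  - move=> s; apply: is_derive_bexp => Q.
    exact: (is_derive_scale _ (is_derive_geo _ _)).
  - rewrite psi0 mulr0 /bexp big1 // => Q _.
    by rewrite geo_at0 !mulr0.
  move=> s s01; rewrite -mulrA; apply: le_trans (bexp_point y01 z01 s01) _.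
  by rewrite le_eqVlt; apply/orP; left; apply/eqP; apply: eq_bexp => Q; rewrite !mulrA.
suff step3 z : 0 <= z <= 1 -> coef y * (psi z ^+ 2 / 2) <=
    bexp E (fun g => r g) (fun Q => (D \subset Q)%:R *
      ((1 - y) ^+ k1 Q * geo2 (k2 Q) (k3 Q) z)) by exact: step3.
move: z.
apply: (le_of_le_deriv (F := fun z => coef y * (psi z ^+ 2 / 2))
  (f := fun z => coef y * expR (- eta * z) * psi z)
  (g := fun z => bexp E (fun g => r g) (fun Q => (D \subset Q)%:R *
    ((1 - y) ^+ k1 Q * (1 - z) ^+ k2 Q) * geo (k3 Q) z))).
- move=> z; apply: (is_derive_ext _ _ (is_derive_scale (coef y / 2)
    (is_derive_pow 1 (dpsi z)))) => [t|]; by field.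
- move=> z; apply: is_derive_bexp => Q.
  apply: (is_derive_ext _ _ (is_derive_scale ((D \subset Q)%:R * (1 - y) ^+ k1 Q)
    (is_derive_geo2 (k2 Q) (k3 Q) z))) => [t|]; by rewrite !mulrA.
- rewrite psi0 expr0n mul0r mulr0 /bexp big1 // => Q _.
  by rewrite geo2_at0 !mulr0.
by move=> z z01; apply: step2.
Qed.

End Blocking.

Local Notation xe := (x e).
Local Notation mass f := (\sum_(h in blockers e f) x h).
Local Notation vmass f := (\sum_(h in blockers e f) x h * (1 - x h)).

Let integrand y := expcubic xe y + \sum_(f in nbr e)
  ((1 + 2 * xe * y) * gain (x f) y +
   (r f * mass f * ((1 + xe * y) * (1 + x f * y) * Aq y) +
    r f * vmass f * ((1 + xe * y) * (1 + x f * y) * Bq y))).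

Let value := wexp xe + \sum_(f in nbr e)
  (wgain xe (x f) + (r f * mass f * wA xe (x f) + r f * vmass f * wB xe (x f))).

Lemma has_wint_integrand : has_wint integrand value.
Proof.
apply: has_wintD; first exact: has_wint_expcubic.
apply: has_wint_sum => f _; apply: has_wintD; first exact: has_wint_gain.
apply: has_wintD; apply: has_wintZ; first exact: has_wint_A.
exact: has_wint_B.
Qed.

Lemma value_ge : wexp xe + 2 * (1 - xe) * wA xe 0 <= value.
Proof.
rewrite /value lerD2l.
have /andP[xe0 xe1] := xI eE.
apply: (@le_trans _ _ (\sum_(f in nbr e)
   (x f * wA xe 0 + 103 / 100 * wA xe 0 / 2 * (x f ^+ 2 - partner_mass E x e f ^+ 2)))).
  rewrite big_split /= -mulr_suml -mulr_sumr sumrB (sum_nbr hE hx eE).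
  have w0 := wA0_ge0 xe0.
  have sq := sum_partner_sq x hE eE.
  rewrite -subr_ge0 in sq.
  have := mulr_ge0 w0 sq; lra.
apply: ler_sum => f fN.
have fE := nbrE fN; have /andP[xf0 xf1] := xI fE.
apply: le_trans (pair_ineq xe0 (xI fE) (partner_mass_ge0 hx e f)) _.
rewrite lerD2l (sum_blockers hE hx eE fN) lerDl.
have am := adjacent_mass_le hE hx eE fN.
apply: mulr_ge0; last exact: wB_ge0.
apply: mulr_ge0; first exact: r_ge0.
apply: sumr_ge0 => h /(subsetP (blockers_sub E e f))/xI/andP[h0 h1].
by rewrite mulr_ge0 // subr_ge0.
Qed.

Lemma expR_double_ge (s : R) : 0 <= s <= 1 ->
  1 + 2 * s + 2 * s ^+ 2 + 4 / 3 * s ^+ 3 <= expR (2 * s).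
Proof.
move=> s01; have /andP[s0 s1] := s01.
have := @expR_ge_taylor R 4 _ s01; rewrite !big_ord_recr big_ord0 /= !factS fact0 => h.
have -> : expR (2 * s) = expR s * expR s by rewrite -expRD; congr expR; ring.
have h' : 1 + s + s ^+ 2 / 2 + s ^+ 3 / 6 <= expR s by apply: le_trans h; lra.
have p0 : 0 <= 1 + s + s ^+ 2 / 2 + s ^+ 3 / 6.
  by rewrite !addr_ge0 // divr_ge0 // exprn_ge0.
apply: le_trans (ler_pM p0 p0 h' h').
have s4 : 0 <= s ^+ 4 by apply: exprn_ge0.
have s5 : 0 <= s ^+ 5 by apply: exprn_ge0.
have s6 : 0 <= s ^+ 6 by apply: exprn_ge0.
by lra.
Qed.

Lemma expR_double_expcubic (y : R) : 0 <= y <= 1 -> expcubic xe y <= expR (2 * (y * xe)).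
Proof.
move=> /andP[y0 y1]; have /andP[xe0 xe1] := xI eE.
have s01 : 0 <= y * xe <= 1 by rewrite mulr_ge0 // mulr_ile1.
by apply: le_trans (expR_double_ge s01); rewrite /expcubic; lra.
Qed.

Lemma prod_nbr_ge (y : R) : 0 <= y <= 1 ->
  expR (- 2 * y) * (expcubic xe y + (1 + 2 * xe * y) * \sum_(f in nbr e) gain (x f) y) <=
  \prod_(g in nbr e) (1 - y * r g).
Proof.
move=> y01; have /andP[y0 y1] := y01; have /andP[xe0 xe1] := xI eE.
have g0 f : f \in nbr e -> 0 <= gain (x f) y.
  by move=> fN; apply: gain_ge0 => //; apply/xI/nbrE.
apply: (@le_trans _ _ (\prod_(g in nbr e) (expR (- (y * x g)) * (1 + gain (x g) y)))).
  rewrite [leRHS]big_split /= prod_expR (sum_nbr hE hx eE).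
  have -> : expR (- (y * (2 - 2 * xe))) = expR (- 2 * y) * expR (2 * (y * xe)).
    by rewrite -expRD; congr expR; ring.
  rewrite -[leRHS]mulrA ler_wpM2l ?expR_ge0 //.
  have S0 : 0 <= \sum_(f in nbr e) gain (x f) y by apply: sumr_ge0.
  have := prod_add1_ge g0 => /(ler_wpM2l (expR_ge0 (2 * (y * xe)))); apply: le_trans.
  rewrite mulrDr mulr1; apply: lerD; first exact: expR_double_expcubic.
  apply: ler_wpM2r => //; apply: le_trans (expR_double_expcubic y01).
  have q2 : 0 <= xe ^+ 2 * y ^+ 2 by rewrite mulr_ge0 ?exprn_ge0.
  have q3 : 0 <= xe ^+ 3 * y ^+ 3 by rewrite mulr_ge0 ?exprn_ge0.
  by rewrite /expcubic; lra.
apply: ler_prod => g /nbrE gE; rewrite expR_gain_le ?xI // andbT.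
by rewrite mulr_ge0 ?expR_ge0 // addr_ge0 // gain_ge0 // xI.
Qed.

Lemma prod_rivals1_ge f (y : R) : f \in nbr e -> 0 <= y <= 1 ->
  expR (- 2 * y) * ((1 + xe * y) * (1 + x f * y)) <=
  \prod_(g in rivals1 E e f) (1 - y * r g).
Proof.
move=> fN y01; have /andP[y0 y1] := y01; have /andP[xe0 xe1] := xI eE.
have /andP[xf0 xf1] := xI (nbrE fN).
have sumA : \sum_(g in rivals1 E e f) x g <= 2 - 2 * xe - x f.
  have sumD : \sum_(g in nbr e) x g = x f + \sum_(g in rivals1 E e f) x g.
    by rewrite (big_setD1 f fN).
  by have := sum_nbr hE hx eE; rewrite sumD; lra.
apply: le_trans (prod_survive_ge (rivals1_sub E e f) y01 sumA).
have -> : expR (- (y * (2 - 2 * xe - x f))) =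
    expR (- 2 * y) * (expR (2 * (xe * y)) * expR (x f * y)).
  by rewrite -!expRD; congr expR; ring.
rewrite ler_wpM2l ?expR_ge0 //; apply: ler_pM.
- by rewrite addr_ge0 // mulr_ge0.
- by rewrite addr_ge0 // mulr_ge0.
- have xy0 : 0 <= xe * y by rewrite mulr_ge0.
  by apply: le_trans (expR_ge1Dx _); lra.
exact: expR_ge1Dx.
Qed.

Lemma bexp_first (y : R) :
  bexp E (fun g => r g) (fun Q => ([set e] \subset Q)%:R * (1 - y) ^+ #|nbr e :&: Q|) =
  r e * \prod_(g in nbr e) (1 - y * r g).
Proof.
have eD : [set e] \subset E by rewrite sub1set.
have dD : [disjoint [set e] & nbr e] by rewrite disjoints1 nbr_irr.
have d0 (S : {set {set V}}) : [disjoint S & (set0 : {set {set V}})].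
  by rewrite disjoint_sym disjoints_subset sub0set.
have nE : nbr e \subset E by apply/subsetP => g /nbrE.
have := bexp_blocks (fun g => r g) (1 - y) 1 1 eD nE (sub0set E) (sub0set E)
   dD (d0 _) (d0 _) (d0 _) (d0 _) (d0 _).
rewrite big_set1 !big_set0 !mulr1 => h.
transitivity (r e * \prod_(g in nbr e) (1 - (1 - (1 - y)) * r g)); last first.
  by congr *%R; apply: eq_bigr => g _; ring.
rewrite -h; apply: eq_bexp => Q.
by rewrite !expr1n !mulr1.
Qed.

Let Hfun y := bexp E (fun g => r g) (fun Q =>
  ([set e] \subset Q)%:R * geo #|nbr e :&: Q| y +
  \sum_(f in nbr e) \sum_(h in blockers e f) ([set e; f; h] \subset Q)%:R *
    geo3 #|rivals1 E e f :&: Q| #|rivals2 E e f h :&: Q| #|rivals3 E e f h :&: Q| y).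

Let hfun y := bexp E (fun g => r g) (fun Q =>
  ([set e] \subset Q)%:R * (1 - y) ^+ #|nbr e :&: Q| +
  \sum_(f in nbr e) \sum_(h in blockers e f) ([set e; f; h] \subset Q)%:R *
    ((1 - y) ^+ #|rivals1 E e f :&: Q| *
     geo2 #|rivals2 E e f h :&: Q| #|rivals3 E e f h :&: Q| y)).

Lemma is_derive_Hfun t : is_derive t (1 : R) Hfun (hfun t).
Proof.
apply: is_derive_bexp => Q.
apply: (is_derive_add (is_derive_scale _ (is_derive_geo _ _))).
apply: is_derive_bigsum => f; apply: is_derive_bigsum => h.
exact: (is_derive_scale _ (is_derive_geo3 _ _ _ _)).
Qed.

Lemma hfun_ge y : 0 <= y <= 1 -> r e * (expR (- 2 * y) * integrand y) <= hfun y.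
Proof.
move=> y01; rewrite /hfun bexpD bexp_first bexp_sum /integrand.
have -> : r e * (expR (- 2 * y) * (expcubic xe y + \sum_(f in nbr e)
  ((1 + 2 * xe * y) * gain (x f) y +
   (r f * mass f * ((1 + xe * y) * (1 + x f * y) * Aq y) +
    r f * vmass f * ((1 + xe * y) * (1 + x f * y) * Bq y))))) =
  r e * (expR (- 2 * y) * (expcubic xe y +
    (1 + 2 * xe * y) * \sum_(f in nbr e) gain (x f) y))
  + \sum_(f in nbr e) \sum_(h in blockers e f)
      r e * r f * (expR (- 2 * y) * ((1 + xe * y) * (1 + x f * y))) *
        (x h * (Aq y + (1 - x h) * Bq y)).
  rewrite big_split /= -mulr_sumr addrA mulrDr mulrDr; congr +%R.
  rewrite mulrA mulr_sumr; apply: eq_bigr => f _.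
  rewrite -[RHS]mulr_sumr.
  have -> : \sum_(h in blockers e f) x h * (Aq y + (1 - x h) * Bq y) =
      mass f * Aq y + vmass f * Bq y.
    rewrite !mulr_suml -big_split /=; apply: eq_bigr => h _; ring.
  ring.
apply: lerD; first by rewrite ler_wpM2l ?r_ge0 // prod_nbr_ge.
apply: ler_sum => f fN; rewrite bexp_sum; apply: ler_sum => h hB.
have hE' := subsetP (blockers_sub E e f) _ hB.
have [psi psi_ge] := bexp_blocking fN hB y01; apply: le_trans.
have -> : r e * r f * r h * \prod_(g in rivals1 E e f) (1 - y * r g) * (psi ^+ 2 / 2) =
  r e * r f * (\prod_(g in rivals1 E e f) (1 - y * r g)) *
   (x h * (a1 (x h) * (psi ^+ 2 / 2))) by ring.
have rr : 0 <= r e * r f by exact: mulr_ge0 (r_ge0 eE) (r_ge0 (nbrE fN)).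
have h0 : 0 <= x h by case/andP: (xI hE').
have /andP[y0 _] := y01.
apply: ler_pM.
- rewrite mulr_ge0 // mulr_ge0 ?expR_ge0 //.
  have /andP[? _] := xI eE; have /andP[? _] := xI (nbrE fN).
  by rewrite mulr_ge0 // addr_ge0 // mulr_ge0.
- by rewrite mulr_ge0 // AB_ge0 // xI.
- by rewrite ler_wpM2l // prod_rivals1_ge.
by rewrite ler_wpM2l // AB_le // xI.
Qed.

Lemma selection_bound : gamma R * x e <= selection_prob E x (@a1 R) e.
Proof.
apply: le_trans (selection_prob_ge eE xI aI).
have -> : bexp E (fun f => x f * a1 (x f)) (chain_weight R E e) = Hfun 1.
  apply: eq_bexp => Q; rewrite /chain_weight geo_at1; congr +%R.
  by apply: eq_bigr => f _; apply: eq_bigr => h _; rewrite geo3_at1.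
have H0 : Hfun 0 = 0.
  rewrite /Hfun /bexp big1 // => Q _; rewrite geo_at0 mulr0 add0r big1 ?mulr0 // => f _.
  by rewrite big1 // => h _; rewrite geo3_at0 mulr0.
have := le_wint has_wint_integrand is_derive_Hfun hfun_ge; rewrite H0 subr0.
apply: le_trans; rewrite mulrC -mulrA; have /andP[xe0 _] := xI eE.
apply: ler_wpM2l => //; apply: le_trans (final_ineq (xI eE)) _.
by apply: ler_wpM2l value_ge; case/andP: (aI eE).
Qed.

End SelectionBound.

Theorem theorem3 (R : realType) (V : finType) (E : {set {set V}})
    (x : {set V} -> R) (hE : simple_graph E) (hx : one_regular E x) :
  (forall f : {set V}, f \in E ->
     gamma R * x f <= selection_prob E x (@a1 R) f) /\
  474 / 10 ^+ 3 + 35 / 10 ^+ 6 <= gamma R.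
Proof.
split; last exact: gamma_ge.
by move=> f fE; apply: selection_bound.
Qed.
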